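(* Let $d\ge1$ be an integer. Every almost injective function $f\colon\mathrm{sk}_d(\Delta_{2d+2})\to\mathbb{R}^{2d}$ (not assumed continuous) satisfies $\alpha^{(2)}(f)\ge r_{2d-1}=\arccos\left(\frac{-1}{2d}\right)$.
   Context: $K=\mathrm{sk}_d(\Delta_{2d+2})$ is the $d$-skeleton of the $(2d+2)$-simplex (geometric realization). A function $f\colon K\to\mathbb{R}^{m}$ is almost injective if $f(\sigma)\cap f(\tau)=\emptyset$ for any two disjoint faces $\sigma,\tau$ of $K$. The 2-fold deleted product is $\mathrm{Conf}_2^{\Delta}(K)=\{(x,y)\in K\times K: x,y \text{ lie in disjoint faces of } K\}$ with the subspace topology. For almost injective $f\colon K\to\mathbb{R}^{2d}$, define $P_f\colon\mathrm{Conf}_2^{\Delta}(K)\to S^{2d-1}$, $P_f(x,y)=\frac{f(x)-f(y)}{\|f(x)-f(y)\|}$, where $S^{2d-1}$ carries the geodesic metric $d(u,v)=\arccos\langle u,v\rangle$, and $\alpha^{(2)}(f)=\delta(P_f)$. Here for a topological space $X$ and a metric space $Y$, $\delta(g)=\inf\{\delta\ge 0 : \text{for every } x\in X \text{ there is an open neighborhood } U_x \text{ of } x \text{ with } \operatorname{diam}(g(U_x))\le\delta\}$. For $n\ge0$, $r_n=\arccos\left(\frac{-1}{n+1}\right)$. *)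

(* Defs.v *)
From HB Require Import structures.
From mathcomp Require Import all_boot all_order all_algebra.
From mathcomp Require Import classical_sets reals trigo.
Set Implicit Arguments. Unset Strict Implicit. Unset Printing Implicit Defensive.
Import Order.TTheory GRing.Theory Num.Theory.
Local Open Scope ring_scope.


Section Defs.
Variables (R : realType) (d : nat).

(* Vertices of Delta_{2d+2}: 'I_(2d+3).  Points: barycentric coordinate vectors. *)
Definition pt := 'I_(2 * d + 3) -> R.
Definition vec := 'I_(2 * d) -> R.

Definition is_face (s : {set 'I_(2 * d + 3)}) : Prop :=
  s != finset.set0 /\ (#|s| <= d.+1)%N.

Definition in_face (x : pt) (s : {set 'I_(2 * d + 3)}) : Prop :=
  (forall i, 0 <= x i) /\ \sum_i x i = 1 /\ (forall i, i \notin s -> x i = 0).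

Definition in_K (x : pt) : Prop := exists s, is_face s /\ in_face x s.

Definition Conf2 (x y : pt) : Prop :=
  exists s t, [/\ is_face s, is_face t, [disjoint s & t], in_face x s & in_face y t].

(* Almost injectivity (f only matters on K). *)
Definition almost_injective (f : pt -> vec) : Prop :=
  forall s t, is_face s -> is_face t -> [disjoint s & t] ->
  forall x y, in_face x s -> in_face y t -> f x <> f y.

Definition dotv (u v : vec) : R := \sum_j u j * v j.
Definition normv (u : vec) : R := Num.sqrt (dotv u u).

Definition Pf (f : pt -> vec) (x y : pt) : vec :=
  fun j => (f x j - f y j) / normv (fun k => f x k - f y k).

Definition sdist (u v : vec) : R := acos (dotv u v).

Definition near2 (x y x' y' : pt) (e : R) : Prop :=
  forall i, `|x' i - x i| < e /\ `|y' i - y i| < e.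

(* delta is admissible: each point of Conf2 has an open neighbourhood
   (w.l.o.g. a basic one: ball intersected with Conf2) whose image under P_f
   has diameter <= delta. *)
Definition admissible (f : pt -> vec) (delta : R) : Prop :=
  0 <= delta /\
  forall x y, Conf2 x y -> exists2 e : R, 0 < e &
    forall x1 y1 x2 y2, Conf2 x1 y1 -> Conf2 x2 y2 ->
      near2 x y x1 y1 e -> near2 x y x2 y2 e ->
      sdist (Pf f x1 y1) (Pf f x2 y2) <= delta.

Definition alpha2 (f : pt -> vec) : R := inf [set delta | admissible f delta]%classic.

End Defs.

(* Main.v *)
Require Import Defs.
From HB Require Import structures.
From mathcomp Require Import all_boot all_order all_algebra.
From mathcomp Require Import classical_sets reals trigo.
From mathcomp Require Import boolp filter topology normedtype.
From mathcomp Require Import finset zify ring lra.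
Import Order.TTheory GRing.Theory Num.Theory.
Import numFieldNormedType.Exports.
Local Open Scope ring_scope.
Set Implicit Arguments. Unset Strict Implicit. Unset Printing Implicit Defensive.

(** Suppose that some [delta < arccos (-1/2d)] is admissible. On a fine
    subdivision of the deleted product, [P_f] maps the vertices of each simplex
    to at most [2d+1] unit vectors of [R^2d] with pairwise inner products at
    least [cos delta > -1/2d]; expanding [|sum l_i u_i|^2] shows that their
    convex hull stays away from 0. Extending affinely and subdividing again
    yields an antipodal labelling by signed coordinates without complementary
    edges. Ky Fan's cochain [theta] (mod 2, "labels alternate in sign") satisfies
    [d theta = theta + theta o antipode] and vanishes on [2d]-dimensional
    simplices. Pulled back to the cells [s x t] of the deleted product it gives
    [X] with [X(s,t) + X(t,s) = dX(s,t)]. For a vertex set [W] with [2k+1]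
    elements let [A_k] be the sum of [X(s,t)] over disjoint [k]-subsets of [W].
    Summing the relation over half of the cells, twice, lowers [k] by one and
    removes two vertices from [W]; so [A_(d+1) = A_1 = X(empty) = 1], while
    [X = 0] on the top cells. All cochains are functions on tuples of points,
    pulled back along subdivisions, so no triangulation is ever constructed. *)

(** * Cochains mod 2 and sums over flags *)

Definition cob (E : Type) (F : E -> seq E) (psi : E -> bool) (e : E) : bool :=
  \big[addb/false]_(e' <- F e) psi e'.

Lemma cob_add (E : Type) (F : E -> seq E) (phi psi : E -> bool) e :
  cob F (fun x => phi x (+) psi x) e = cob F phi e (+) cob F psi e.
Proof. exact: big_split. Qed.

Lemma eq_cob (E : Type) (F : E -> seq E) (phi psi : E -> bool) e :
  phi =1 psi -> cob F phi e = cob F psi e.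
Proof. by move=> eq_phi; apply: eq_bigr => x _; apply: eq_phi. Qed.

(** A one-point tuple has the face [[::]], so the complex of tuples is augmented. Tuples may have
    repeated entries. *)
Fixpoint faces (V : Type) (s : seq V) : seq (seq V) :=
  if s is x :: s' then s' :: map (cons x) (faces s') else [::].

Lemma cob_faces_cons (V : Type) (phi : seq V -> bool) x s :
  cob (@faces V) phi (x :: s) =
  phi s (+) cob (@faces V) (fun t => phi (x :: t)) s.
Proof. by rewrite /cob /= big_cons big_map. Qed.

Lemma cob_faces_map (V W : Type) (g : V -> W) (phi : seq W -> bool) s :
  cob (@faces W) phi (map g s) = cob (@faces V) (fun t => phi (map g t)) s.
Proof.
elim: s phi => [|x s IHs] phi; first by rewrite /cob /= !big_nil.
by rewrite /= !cob_faces_cons IHs.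
Qed.

Lemma cob_facesK (V : Type) (phi : seq V -> bool) s :
  cob (@faces V) (cob (@faces V) phi) s = false.
Proof.
elim: s phi => [|x s IHs] phi; first by rewrite /cob big_nil.
rewrite cob_faces_cons (eq_cob _ _ (fun t => cob_faces_cons phi x t)).
by rewrite cob_add IHs addbF addbb.
Qed.

Lemma size_faces (V : eqType) (s t : seq V) :
  t \in faces s -> size s = (size t).+1.
Proof.
elim: s t => [|x s IHs] t //=; rewrite inE => /predU1P[->//|].
by case/mapP => u /IHs -> ->.
Qed.

Lemma mem_faces (V : eqType) (s t : seq V) :
  t \in faces s -> {subset t <= s}.
Proof.
elim: s t => [|x s IHs] t //=; rewrite inE => /predU1P[->|].
  by move=> y ys; rewrite inE ys orbT.
case/mapP => u /IHs us -> y; rewrite !inE => /predU1P[->|/us ->]; by rewrite ?eqxx ?orbT.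
Qed.

(* The dual of barycentric subdivision: the sum of [phi] over all flags
   [e > e' > ...] of length [n], each read as the tuple of its barycentres. *)
Fixpoint flags (E V : Type) (F : E -> seq E) (b : E -> V) (n : nat)
    (phi : seq V -> bool) (e : E) : bool :=
  if n is n'.+1 then cob F (flags F b n' (fun s => phi (b e :: s))) e
  else phi [::].

Section Flags.
Variables (E V : Type) (F : E -> seq E) (b : E -> V).

Lemma eq_flags n (phi psi : seq V -> bool) e :
  phi =1 psi -> flags F b n phi e = flags F b n psi e.
Proof.
elim: n phi psi e => [|n IHn] phi psi e eq_phi /=; first exact: eq_phi.
by apply: eq_cob => e'; apply: IHn => s; apply: eq_phi.
Qed.

Lemma flags_add n (phi psi : seq V -> bool) e :
  flags F b n (fun s => phi s (+) psi s) e =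
  flags F b n phi e (+) flags F b n psi e.
Proof.
elim: n phi psi e => [//|n IHn] phi psi e /=.
by rewrite -cob_add; apply: eq_cob => e1; rewrite -IHn.
Qed.

(** Subdivision is a cochain map. Deleting the top barycentre [b e] leaves the flags of the faces of
    [e], which is the right-hand side; deleting a later one gives, by induction, [cob F] of a
    [cob F], which vanishes. *)
Lemma flags_cob n (phi : seq V -> bool) e :
  (forall psi e', cob F (cob F psi) e' = false) ->
  flags F b n.+1 (cob (@faces V) phi) e = cob F (flags F b n phi) e.
Proof.
move=> FK; elim: n phi e => [|n IHn] phi e.
  by apply: eq_cob => e' /=; rewrite cob_faces_cons /cob big_nil addbF.
have flagsS : forall k psi e', flags F b k.+1 psi e' =
    cob F (flags F b k (fun s => psi (b e' :: s))) e' by [].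
rewrite flagsS.
rewrite (@eq_cob _ _ _ (fun e' => flags F b n.+1 phi e' (+)
    flags F b n.+1 (cob (@faces V) (fun s => phi (b e :: s))) e')); last first.
  move=> e'; rewrite -flags_add; apply: eq_flags => s; exact: cob_faces_cons.
by rewrite cob_add (eq_cob _ _ (fun e' => IHn _ e')) FK addbF.
Qed.

End Flags.

Lemma flags_map (E E' V V' : Type) (F : E -> seq E) (F' : E' -> seq E')
    (b : E -> V) (b' : E' -> V') (h : E -> E') (g : V -> V') :
  (forall psi e, cob F' psi (h e) = cob F (fun x => psi (h x)) e) ->
  (forall e, b' (h e) = g (b e)) ->
  forall n phi e,
  flags F' b' n phi (h e) = flags F b n (fun s => phi (map g s)) e.
Proof.
move=> hF hb; elim=> [|n IHn] phi e //=.
by rewrite hF; apply: eq_cob => x; rewrite IHn hb.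
Qed.

(** * The Ky Fan cochain *)

Fixpoint alternating (b : bool) (s : seq bool) : bool :=
  if s is c :: s' then (c == b) && alternating (~~ b) s' else true.

(** If [s] alternates, exactly one deletion leaves a sequence alternating from [b]: that of the last
    entry if [s] starts with [b], of the first otherwise. If [s] does not alternate but some
    deletion does, [s] has a single pair of equal neighbours, and deleting either gives the same
    sequence, so the two cancel. *)
Lemma cob_alternating b s : s != [::] ->
  cob (@faces bool) (alternating b) s = alternating b s (+) alternating (~~ b) s.
Proof.
elim: s b => [//|c s IHs] b _; rewrite cob_faces_cons /=.
have -> : cob (@faces bool) (fun t => (c == b) && alternating (~~ b) t) s =
          (c == b) && cob (@faces bool) (alternating (~~ b)) s.
  by case: (c == b) => //; rewrite /cob big1.
case: s IHs => [|c' s] IHs; first by rewrite /cob big_nil; case: c b => [] [].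
rewrite IHs // negbK; move: (alternating _ _) (alternating _ _).
by case: c b {IHs} => [] [] [] [].
Qed.

(* The label [2 * i + 1] stands for [+ i] and [2 * i] for [- i]. *)
Definition kyfan (b : bool) (l : seq nat) : bool :=
  alternating b (map odd (sort leq l)).

Lemma kyfan_perm b l1 l2 : perm_eq l1 l2 -> kyfan b l1 = kyfan b l2.
Proof.
by move=> /(perm_sortP leq_total leq_trans anti_leq) eq12; rewrite /kyfan eq12.
Qed.

(** For a symmetric [phi] it does not matter which of several equal entries is deleted. Indexing the
    sum by values makes its invariance under permutation visible, as needed to replace [l] by its
    sorted version. *)
Lemma cob_faces_rem (phi : seq nat -> bool) l :
  (forall l1 l2, perm_eq l1 l2 -> phi l1 = phi l2) ->
  cob (@faces nat) phi l = \big[addb/false]_(x <- l) phi (rem x l).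
Proof.
elim: l phi => [|x l IHl] phi phiP; first by rewrite /cob !big_nil.
rewrite cob_faces_cons big_cons /= eqxx; congr addb.
rewrite IHl => [|l1 l2 l12]; last by apply: phiP; rewrite perm_cons.
rewrite big_seq [RHS]big_seq; apply: eq_bigr => y yl; apply: phiP.
case: eqP => [->|_] //=.
by rewrite perm_sym; apply: perm_to_rem.
Qed.

Lemma cob_faces_perm (phi : seq nat -> bool) l1 l2 :
  (forall l1 l2, perm_eq l1 l2 -> phi l1 = phi l2) -> perm_eq l1 l2 ->
  cob (@faces nat) phi l1 = cob (@faces nat) phi l2.
Proof.
move=> phiP l12; rewrite !cob_faces_rem // (perm_big l2) //=.
rewrite big_seq [RHS]big_seq; apply: eq_bigr => x xl; apply: phiP.
have xl1 : x \in l1 by rewrite (perm_mem l12).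
by rewrite -(perm_cons x) -(permPl (perm_to_rem xl1)) -(permPr (perm_to_rem xl)).
Qed.

Lemma sorted_faces l t : sorted leq l -> t \in faces l -> sorted leq t.
Proof.
move=> ls tl; apply: (subseq_sorted leq_trans) ls.
elim: l t tl => [|x l IHl] t //=; rewrite inE => /predU1P[->|].
  exact: subseq_cons.
by case/mapP => u /IHl ul ->; rewrite /= eqxx.
Qed.

Lemma cob_kyfan b l : l != [::] ->
  cob (@faces nat) (kyfan b) l = kyfan b l (+) kyfan (~~ b) l.
Proof.
move=> l0.
rewrite (cob_faces_perm (@kyfan_perm b) (l2 := sort leq l)); last first.
  by rewrite perm_sym perm_sort.
rewrite [in RHS]/kyfan -cob_alternating; last first.
  by rewrite -!size_eq0 size_map size_sort size_eq0.
rewrite cob_faces_map /cob big_seq [RHS]big_seq; apply: eq_bigr => t.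
move=> /(sorted_faces (sort_sorted leq_total l)) ts.
by rewrite /kyfan sorted_sort //; apply: leq_trans.
Qed.

Definition flip (a : nat) : nat := if odd a then a.-1 else a.+1.

Definition complement_free (l : seq nat) : Prop :=
  forall a, a \in l -> flip a \notin l.

Lemma odd_flip a : odd (flip a) = ~~ odd a.
Proof. by rewrite /flip; case: ifP => h /=; lia. Qed.

Lemma alternating_negb b s : alternating b (map negb s) = alternating (~~ b) s.
Proof. by elim: s b => [|c s IHs] b //=; rewrite IHs; case: c b => [] []. Qed.

(** Flipping moves a label only within its pair [2i, 2i+1]. As no two labels of [l] are
    complementary, the order is preserved, so [flip] commutes with sorting and just negates every
    sign. *)
Lemma kyfan_flip b l : complement_free l ->
  kyfan b (map flip l) = kyfan (~~ b) l.
Proof.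
move=> lcf; rewrite /kyfan -alternating_negb.
suff -> : sort leq (map flip l) = map flip (sort leq l).
  by rewrite -!map_comp; congr alternating; apply: eq_map => a /=; rewrite odd_flip.
apply: (sorted_eq leq_trans anti_leq); first exact: sort_sorted leq_total _.
  rewrite sorted_map; apply: (@sub_in_sorted _ (mem l) leq (relpre flip leq)).
  - move=> a c al cl ac; rewrite /relpre /= /flip.
    have := lcf a al; rewrite /flip.
    case: ifP => oa; case: ifP => oc /negP nl; try lia.
    have : a.+1 <> c by move=> E; apply: nl; rewrite E.
    lia.
  - by apply/allP => x; rewrite mem_sort.
  exact: sort_sorted leq_total _.
by rewrite perm_sort perm_map // perm_sym perm_sort.
Qed.

(** Consecutive labels have opposite signs; with equal halves they would be complementary. *)
Lemma alternating_halves b l : complement_free l -> sorted leq l ->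
  alternating b (map odd l) -> sorted ltn (map half l).
Proof.
move=> lcf; elim: l b lcf => [|x l IHl] b lcf //=.
case: l IHl lcf => [//|y l] IHl lcf /=; case/andP=> xy yl /andP[/eqP ox].
move=> alt; apply/andP; split; last first.
  apply: (IHl (~~ b)) => // a al.
  have : a \in x :: y :: l by rewrite in_cons al orbT.
  by move=> /lcf; rewrite in_cons negb_or => /andP[].
have := lcf x (mem_head _ _); rewrite !in_cons !negb_or => /and3P[_ xy' _].
move: alt xy'; rewrite /= => /andP[/eqP oy _]; rewrite /flip; case: ifP => h /eqP.
  by move: b ox oy => []; lia.
by move: b ox oy => []; lia.
Qed.

(** Pigeonhole: alternation would give more than [n] distinct coordinates out of [n]. *)
Lemma kyfan_top b n l : complement_free l -> all (fun a => a < n.*2)%N l ->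
  (n < size l)%N -> kyfan b l = false.
Proof.
move=> lcf ln nl; apply/negP => /alternating_halves.
have /[swap] /[apply] : complement_free (sort leq l).
  by move=> a; rewrite !mem_sort => /lcf.
move=> /(_ (sort_sorted leq_total l)) hs.
have := @uniq_leq_size _ (map half (sort leq l)) (iota 0 n).
rewrite (sorted_uniq ltn_trans ltnn hs) size_map size_sort size_iota.
have sub : {subset map half (sort leq l) <= iota 0 n}.
  move=> x /mapP[a]; rewrite mem_sort => /(allP ln) an ->.
  by rewrite mem_iota; lia.
by move=> /(_ isT sub); lia.
Qed.

(** * Barycentric subdivision of affine tuples *)

Section Subdivision.
Variables (R : realType) (p : nat).
Implicit Types (x y : 'rV[R]_p) (t : seq 'rV[R]_p).

Definition bary t : 'rV[R]_p := (size t)%:R^-1 *: \sum_(x <- t) x.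

Definition sd (phi : seq 'rV[R]_p -> bool) t : bool :=
  flags (@faces _) bary (size t) phi t.

Lemma eq_sd phi psi t : phi =1 psi -> sd phi t = sd psi t.
Proof. exact: eq_flags. Qed.

Lemma sd_cob phi t : sd (cob (@faces _) phi) t = cob (@faces _) (sd phi) t.
Proof.
rewrite /sd; case: t => [|x t]; first by rewrite /= /cob !big_nil.
rewrite [size _]/= flags_cob; last exact: cob_facesK.
rewrite /cob big_seq [RHS]big_seq; apply: eq_bigr => s st.
by have [->] := size_faces st.
Qed.

Lemma iter_sd_cob m phi t :
  iter m sd (cob (@faces _) phi) t = cob (@faces _) (iter m sd phi) t.
Proof.
elim: m phi t => [//|m IHm] phi t.
by rewrite !iterS -sd_cob; apply: eq_sd => s.
Qed.

Lemma iter_sd_add m phi psi t :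
  iter m sd (fun s => phi s (+) psi s) t = iter m sd phi t (+) iter m sd psi t.
Proof.
elim: m phi psi t => [//|m IHm] phi psi t.
by rewrite !iterS -[RHS]flags_add; apply: eq_sd => s.
Qed.

(** A substitute for convexity: it is all that keeps the vertices of a subdivision inside a cell or
    a hull. *)
Definition bary_closed (Q : 'rV[R]_p -> Prop) : Prop :=
  forall t, t != [::] -> (forall x, x \in t -> Q x) -> Q (bary t).

Definition spread (D : R) t : Prop :=
  forall x y, x \in t -> y \in t -> forall i, `|x 0 i - y 0 i| <= D.

Lemma bary_coord t i : bary t 0 i = (size t)%:R^-1 * \sum_(x <- t) x 0 i.
Proof. by rewrite mxE summxE. Qed.

Lemma bary_closed_le (l : 'rV[R]_p -> R) (c : R) :
  (forall x y, l (x + y) = l x + l y) -> (forall a x, l (a *: x) = a * l x) ->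
  bary_closed (fun x => l x <= c).
Proof.
move=> lD lZ t t0 tc; rewrite /bary lZ.
have t0' : (0 : R) < (size t)%:R by rewrite ltr0n lt0n size_eq0.
rewrite mulrC ler_pdivrMr //.
elim: t tc {t0 t0'} => [|x t IHt] tc.
  rewrite big_nil mulr0; have := lZ 0 0; rewrite scale0r mul0r => ->; exact: lexx.
rewrite big_cons lD /= -natr1 mulrDr mulr1 addrC lerD ?tc ?mem_head //.
by apply: IHt => y yt; apply: tc; rewrite in_cons yt orbT.
Qed.

Lemma bary_closed_ge (l : 'rV[R]_p -> R) (c : R) :
  (forall x y, l (x + y) = l x + l y) -> (forall a x, l (a *: x) = a * l x) ->
  bary_closed (fun x => c <= l x).
Proof.
move=> lD lZ t t0 tc; rewrite -lerN2.
apply: (@bary_closed_le (fun x => - l x)) t0 _.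
- by move=> x y; rewrite lD opprD.
- by move=> a x; rewrite lZ mulrN.
- by move=> x /tc; rewrite lerN2.
Qed.

Lemma bary_closed_and (Q Q' : 'rV[R]_p -> Prop) :
  bary_closed Q -> bary_closed Q' -> bary_closed (fun x => Q x /\ Q' x).
Proof. by move=> cQ cQ' t t0 tQ; split; [apply: cQ|apply: cQ'] => // x /tQ[]. Qed.

Lemma bary_closed_forall (I : Type) (Q : I -> 'rV[R]_p -> Prop) :
  (forall i, bary_closed (Q i)) -> bary_closed (fun x => forall i, Q i x).
Proof. by move=> cQ t t0 tQ i; apply: cQ => // x /tQ. Qed.

Lemma bary_closed_ball (c : 'rV[R]_p) (D : R) :
  bary_closed (fun x => forall i, `|c 0 i - x 0 i| <= D).
Proof.
have e : forall x i, `|c 0 i - x 0 i| <= D <->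
    x 0 i <= c 0 i + D /\ c 0 i - D <= x 0 i.
  move=> x i; rewrite ler_norml; split; first by case/andP => *; split; lra.
  by case=> *; apply/andP; split; lra.
have cl : bary_closed (fun x => forall i, x 0 i <= c 0 i + D /\ c 0 i - D <= x 0 i).
  apply: bary_closed_forall => i; apply: bary_closed_and.
    by apply: bary_closed_le => *; rewrite mxE.
  by apply: bary_closed_ge => *; rewrite mxE.
by move=> t t0 tD i; apply/e; apply: cl => // x xt j; apply/e; apply: tD.
Qed.

(* One of the differences averaged by [bary t 0 i - x 0 i] vanishes. *)
Lemma bary_dist k (D : R) t x : 0 <= D -> (size t <= k.+1)%N -> spread D t ->
  x \in t -> forall i, `|bary t 0 i - x 0 i| <= k%:R / k.+1%:R * D.
Proof.
move=> D0 tk tD xt i; set n := size t in tk *.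
have n0 : (0 < n)%N by rewrite /n; case: (t) xt.
have n0' : (0 : R) < n%:R by rewrite ltr0n.
have -> : bary t 0 i - x 0 i = n%:R^-1 * \sum_(y <- rem x t) (y 0 i - x 0 i).
  rewrite bary_coord (perm_big _ (perm_to_rem xt)) big_cons /= big_split /= sumrN.
  rewrite big_const_seq iter_addr_0 count_predT size_rem // -/n.
  have -> : x 0 i *+ n.-1 = (n%:R - 1) * x 0 i.
    by rewrite mulrBl mul1r mulr_natl -[in RHS](prednK n0) mulrSr addrK.
  by field; rewrite gt_eqF.
rewrite normrM normfV (ger0_norm (ler0n _ _)).
have le1 : `|\sum_(y <- rem x t) (y 0 i - x 0 i)| <= n.-1%:R * D.
  apply: (le_trans (ler_norm_sum _ _ _)).
  rewrite -(size_rem xt) big_seq; have: {subset rem x t <= t} by exact: mem_rem.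
  move: (rem x t) => s st.
  rewrite mulr_natl -[size s]count_predT -iter_addr_0 -big_const_seq.
  rewrite [leRHS]big_seq.
  by apply: ler_sum => y ys; apply: tD => //; apply: st.
apply: (le_trans (ler_wpM2l _ le1)); first by rewrite invr_ge0 ler0n.
rewrite mulrA ler_wpM2r // ler_pdivlMr ?ltr0n // -mulrA mulrC ler_pdivrMr //.
by rewrite -!natrM ler_nat; nia.
Qed.

(** The mesh estimate of barycentric subdivision, stated dually: the value on [t] depends only on
    [phi] at tuples that stay in [Q] and have diameter shrunk by the factor [k/(k+1)]. *)
Lemma flags_local k (D : R) n phi psi Q t :
  bary_closed Q -> 0 <= D -> size t = n -> (n <= k.+1)%N ->
  (forall x, x \in t -> Q x) -> spread D t ->
  (forall s, size s = n -> (forall x, x \in s -> Q x) ->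
     spread (k%:R / k.+1%:R * D) s -> phi s = psi s) ->
  flags (@faces _) bary n phi t = flags (@faces _) bary n psi t.
Proof.
move=> cQ D0; elim: n phi psi Q t cQ => [|n IHn] phi psi Q t cQ tn nk tQ tD eqs.
  by apply: eqs => // x; rewrite in_nil.
have t0 : t != [::] by rewrite -size_eq0 tn.
rewrite /= /cob big_seq [RHS]big_seq; apply: eq_bigr => t' t't.
have sub := mem_faces t't.
(* Later barycentres of the flag must stay close to [bary t]. A ball around [bary t] is closed under
   barycentres, so this can be carried along in [Q']. *)
set Q' := fun x => Q x /\ forall i, `|bary t 0 i - x 0 i| <= k%:R / k.+1%:R * D.
apply: (IHn _ _ Q').
- by apply: bary_closed_and => //; apply: bary_closed_ball.
- by move: (size_faces t't); rewrite tn => -[].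
- exact: ltnW.
- move=> x /sub xt; split; first exact: tQ.
  by apply: bary_dist => //; rewrite tn.
- by move=> x y /sub xt /sub yt; apply: tD.
have E0 : 0 <= k%:R / k.+1%:R * D by rewrite mulr_ge0 // divr_ge0 ?ler0n.
move=> s sn sQ' sD; apply: eqs => /=.
- by rewrite sn.
- move=> x; rewrite in_cons => /predU1P[->|/sQ'[]//]; exact: cQ.
- move=> x y; rewrite !in_cons => /predU1P[->|xs] /predU1P[->|ys] i.
  + by rewrite subrr normr0.
  + by case: (sQ' _ ys).
  + by rewrite distrC; case: (sQ' _ xs).
  + exact: sD.
Qed.

Lemma iter_sd_local k m (D : R) phi psi Q t :
  bary_closed Q -> 0 <= D -> (size t <= k.+1)%N ->
  (forall x, x \in t -> Q x) -> spread D t ->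
  (forall s, size s = size t -> (forall x, x \in s -> Q x) ->
     spread ((k%:R / k.+1%:R) ^+ m * D) s -> phi s = psi s) ->
  iter m sd phi t = iter m sd psi t.
Proof.
move=> cQ; elim: m D t => [|m IHm] D t D0 tk tQ tD eqs.
  by apply: eqs => //; rewrite mul1r.
rewrite !iterS; apply: (flags_local cQ D0 erefl tk tQ tD) => s st sQ sD.
apply: (IHm _ _ _ _ sQ sD); first by rewrite mulr_ge0 // divr_ge0 ?ler0n.
  by rewrite st.
by move=> r rs rQ rD; apply: eqs => //; rewrite ?rs // exprSr -mulrA.
Qed.

Lemma exists_pow_lt k (D e : R) : 0 <= D -> 0 < e ->
  exists m, (k%:R / k.+1%:R) ^+ m * D < e.
Proof.
move=> D0 e0; set a := k%:R / k.+1%:R.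
have a0 : 0 <= a by rewrite divr_ge0 ?ler0n.
(* The induction rests on [k (k+m+1) <= (k+1)(k+m)]. *)
have bernoulli m : a ^+ m * (k + m)%:R <= k%:R.
  elim: m => [|m IHm]; first by rewrite mul1r addn0.
  apply: le_trans IHm; rewrite exprSr -mulrA ler_wpM2l ?exprn_ge0 //.
  rewrite /a mulrAC ler_pdivrMr ?ltr0n // -!natrM ler_nat; nia.
set m := (Num.Def.archi_bound (k%:R * D / e)).+1; exists m.
have km : (0 : R) < (k + m)%:R by rewrite ltr0n addnS.
have : k%:R * D / e < m%:R.
  apply: lt_le_trans (archi_boundP _) _; first by rewrite divr_ge0 ?mulr_ge0 ?ler0n ?(ltW e0).
  by rewrite ler_nat.
rewrite ltr_pdivrMr // => kDe.
rewrite -(ltr_pM2r km) mulrAC; apply: le_lt_trans (ler_wpM2r D0 (bernoulli m)) _.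
apply: (lt_le_trans kDe); by rewrite mulrC ler_pM2l // ler_nat leq_addl.
Qed.

End Subdivision.

Lemma iter_sd_map (R : realType) (p q : nat) (g : 'rV[R]_p -> 'rV[R]_q) :
  (forall x y, g (x + y) = g x + g y) -> (forall a x, g (a *: x) = a *: g x) ->
  forall m phi t,
  iter m (@sd R q) phi (map g t) =
  iter m (@sd R p) (fun s => phi (map g s)) t.
Proof.
move=> gD gZ; elim=> [//|m IHm] phi t; rewrite !iterS.
transitivity (sd (fun s => iter m (@sd R q) phi (map g s)) t); last first.
  exact: eq_sd.
rewrite /sd size_map; apply: flags_map => [psi s|s]; first exact: cob_faces_map.
rewrite /bary gZ size_map; congr (_ *: _); rewrite big_map.
elim: s => [|x s IHs]; last by rewrite !big_cons gD IHs.
by rewrite !big_nil; have := gZ 0 0; rewrite !scale0r.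
Qed.

(** * Convex hulls of unit vectors *)

Section Hull.
Variables (R : realType) (n : nat).
Implicit Types (u v x y : 'rV[R]_n) (T s : seq 'rV[R]_n).

Definition dot u v : R := \sum_j u 0 j * v 0 j.

Lemma dotC u v : dot u v = dot v u.
Proof. by apply: eq_bigr => j _; rewrite mulrC. Qed.

Lemma dotDl u v x : dot (u + v) x = dot u x + dot v x.
Proof. by rewrite -big_split; apply: eq_bigr => j _; rewrite mxE mulrDl. Qed.

Lemma dotZl a u x : dot (a *: u) x = a * dot u x.
Proof. by rewrite /dot mulr_sumr; apply: eq_bigr => j _; rewrite mxE mulrA. Qed.

Lemma dot_ge0 u : 0 <= dot u u.
Proof. by apply: sumr_ge0 => j _; rewrite -expr2 sqr_ge0. Qed.

Lemma dot_suml (I : finType) (l : I -> R) (w : I -> 'rV[R]_n) x :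
  dot (\sum_i l i *: w i) x = \sum_i l i * dot (w i) x.
Proof.
elim/big_rec2: _ => [|i y1 y2 _ <-]; last by rewrite dotDl dotZl.
by rewrite /dot big1 // => j _; rewrite mxE mul0r.
Qed.

Lemma unit_dot_le1 u v : dot u u = 1 -> dot v v = 1 -> -1 <= dot u v <= 1.
Proof.
move=> u1 v1; have H a : 0 <= 1 + a * dot u v *+ 2 + a ^+ 2.
  have := dot_ge0 (u + a *: v).
  rewrite dotDl dotZl !(dotC _ (u + _)) !dotDl !dotZl u1 v1 (dotC v u).
  by move=> h; rewrite (le_trans h) // le_eqVlt; apply/orP; left; apply/eqP; ring.
by have := H 1; have := H (-1); lra.
Qed.

(** The total weight [w] is free so that points of a hull can be added up one by one before dividing
    by their number. *)
Definition conic_comb T (w : R) x : Prop :=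
  exists l : 'I_(size T) -> R, [/\ forall i, 0 <= l i, \sum_i l i = w
    & x = \sum_i l i *: nth 0 T i].

Definition hull T x : Prop := conic_comb T 1 x.

Lemma hull_mem T x : x \in T -> hull T x.
Proof.
move=> xT; have iT : (index x T < size T)%N by rewrite index_mem.
exists (fun i => (i == Ordinal iT)%:R); split; first by move=> i; rewrite ler0n.
  by rewrite (bigD1 (Ordinal iT)) //= eqxx big1 ?addr0 // => i /negPf ->.
rewrite (bigD1 (Ordinal iT)) //= eqxx big1 ?addr0 ?scale1r ?nth_index //.
by move=> i /negPf ->; rewrite scale0r.
Qed.

Lemma hull_bary_closed T : bary_closed (hull T).
Proof.
move=> s s0 sT.
have [l [l0 l1 lE]] : conic_comb T (size s)%:R (\sum_(x <- s) x).
  elim: s sT {s0} => [|x s IHs] sT.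
    exists (fun=> 0); split=> //; first by rewrite big1.
    by rewrite big_nil big1 // => i _; rewrite scale0r.
  have [l [l0 l1 lE]] : hull T x by apply: sT; rewrite mem_head.
  have [m [m0 m1 mE]] : conic_comb T (size s)%:R (\sum_(x <- s) x).
    by apply: IHs => y ys; apply: sT; rewrite in_cons ys orbT.
  exists (fun i => l i + m i); split; first by move=> i; rewrite addr_ge0.
    by rewrite big_split /= l1 m1 nat1r.
  rewrite big_cons lE mE -big_split.
  by apply: eq_bigr => i _; rewrite /= scalerDl.
have sn0 : (size s)%:R != 0 :> R by rewrite pnatr_eq0 size_eq0.
exists (fun i => (size s)%:R^-1 * l i); split.
- by move=> i; rewrite mulr_ge0 ?invr_ge0 ?ler0n.
- by rewrite -mulr_sumr l1 mulVf.
- rewrite /bary lE scaler_sumr; apply: eq_bigr => i _; by rewrite scalerA.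
Qed.

(** Diagonal products are 1 and the others at least [c], so the squared norm is at least
    [c + (1 - c) * sum l_i^2]; at most [n + 1] weights of sum 1 have a sum of squares at least
    [1/(n+1)]. For [n > 0] the bound vanishes at [c = -1/n], the case of a regular simplex, whence
    the constant [-1/(2d)]. *)
Lemma hull_dot_ge T (c : R) x : (size T <= n.+1)%N -> c <= 1 ->
  (forall u, u \in T -> dot u u = 1) ->
  (forall u v, u \in T -> v \in T -> c <= dot u v) ->
  hull T x -> (1 + n%:R * c) / n.+1%:R <= dot x x.
Proof.
move=> Tn c1 T1 Tc [l [l0 l1 ->]]; set N : R := n.+1%:R.
have N0 : 0 < N by rewrite ltr0n.
have sq : N^-1 <= \sum_i l i ^+ 2.
  have : 0 <= \sum_i (l i - N^-1) ^+ 2 by apply: sumr_ge0 => i _; rewrite sqr_ge0.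
  have -> : \sum_i (l i - N^-1) ^+ 2 =
      \sum_i l i ^+ 2 - 2 * N^-1 * \sum_i l i + \sum_(i < size T) N^-1 ^+ 2.
    rewrite mulr_sumr -sumrB -big_split; apply: eq_bigr => i _ /=; ring.
  rewrite l1 sumr_const card_ord -[_ *+ size T]mulr_natl => h.
  have : (size T)%:R * N^-1 ^+ 2 <= N^-1.
    rewrite expr2 mulrA -[leRHS]mul1r ler_wpM2r ?invr_ge0 ?(ltW N0) //.
    by rewrite ler_pdivrMr // mul1r ler_nat.
  by move: h; rewrite mulr1; move: (_ * _ ^+ 2) => a; move: N^-1 => b; lra.
rewrite dot_suml; under eq_bigr => i _ do rewrite dotC dot_suml.
have -> : (1 + n%:R * c) / N = c + (1 - c) * N^-1.
  by rewrite /N -natr1; field; rewrite natr1 pnatr_eq0.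
apply: (@le_trans _ _ (c + (1 - c) * \sum_i l i ^+ 2)).
  by rewrite lerD2l ler_wpM2l // subr_ge0.
have -> : c + (1 - c) * \sum_i l i ^+ 2 =
    \sum_i l i * \sum_j l j * (c + (1 - c) * (i == j)%:R).
  transitivity (\sum_i (c * l i + (1 - c) * l i ^+ 2)).
    by rewrite big_split /= -!mulr_sumr l1 mulr1.
  apply: eq_bigr => i _.
  have -> : \sum_j l j * (c + (1 - c) * (i == j)%:R) =
      \sum_j (c * l j + (1 - c) * (l j * (i == j)%:R)).
    by apply: eq_bigr => j _; ring.
  rewrite big_split /= -!mulr_sumr l1 (bigD1 i) //= eqxx big1 => [|j]; first by rewrite /=; ring.
  by rewrite eq_sym => /negPf ->; rewrite mulr0.
apply: ler_sum => i _; rewrite ler_wpM2l //; apply: ler_sum => j _.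
rewrite ler_wpM2l //; case: eqP => [->|_].
  by rewrite T1 ?mem_nth //= mulr1 subrKC.
by rewrite mulr0 addr0 Tc ?mem_nth.
Qed.

(** * Signed coordinate labels *)

Definition max_coord u (i : 'I_n) : bool := [forall j, `|u 0 j| <= `|u 0 i|].

(** [pick] depends only on the set of maximal coordinates, which [u] and [- u] share; hence
    antipodality away from 0. The default is reached only for [n = 0]. *)
Definition label u : nat :=
  if [pick i | max_coord u i] is Some i then (i.*2 + (0 < u 0%R i)%R)%N else 0%N.

Lemma max_coord_exists u : (0 < n)%N -> exists i, max_coord u i.
Proof.
move=> n0.
have [i _ ui] := @arg_maxP _ _ _ (Ordinal n0) predT (fun j => `|u 0 j|) isT.
by exists i; apply/forallP => j; apply: ui.
Qed.

Lemma label_spec u : (0 < n)%N ->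
  exists2 i, max_coord u i & label u = (i.*2 + (0 < u 0%R i)%R)%N.
Proof.
move=> n0; rewrite /label; case: pickP => [i ui|no]; first by exists i.
by have [i] := max_coord_exists u n0; rewrite no.
Qed.

Definition bounded_below (r : R) u : Prop := exists i, r <= `|u 0 i|.

Lemma bounded_below_max (r : R) u i :
  bounded_below r u -> max_coord u i -> r <= `|u 0 i|.
Proof. by move=> [j rj] /forallP /(_ j); apply: le_trans. Qed.

Lemma dot_bounded_below (r : R) u : (0 < n)%N -> 0 <= r ->
  n%:R * r ^+ 2 <= dot u u -> bounded_below r u.
Proof.
move=> n0 r0 nr; have [i /forallP ui] := max_coord_exists u n0.
exists i; rewrite -ler_sqr ?nnegrE //.
have : dot u u <= n%:R * `|u 0 i| ^+ 2.
  rewrite mulr_natl -[X in _ *+ X]card_ord -sumr_const.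
  by apply: ler_sum => j _; rewrite -expr2 -real_normK ?num_real // ler_sqr ?nnegrE.
by move=> /(le_trans nr); rewrite ler_pM2l // ltr0n.
Qed.

Lemma label_opp (r : R) u : (0 < n)%N -> 0 < r -> bounded_below r u ->
  label (- u) = flip (label u).
Proof.
move=> n0 r0 ur.
have e : max_coord (- u) =1 max_coord u.
  by move=> j; apply: eq_forallb => k; rewrite !mxE !normrN.
rewrite /label (eq_pick e); case: pickP => [i ui|no]; last first.
  by have [i] := max_coord_exists u n0; rewrite no.
have := lt_le_trans r0 (bounded_below_max ur ui).
rewrite normr_gt0 mxE oppr_gt0 /flip oddD odd_double addFb oddb => ui0.
by case: ltgtP ui0 => //= _ _; lia.
Qed.

Lemma label_lt u : (0 < n)%N -> (label u < n.*2)%N.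
Proof.
move=> n0; have [i _ ->] := label_spec u n0.
by have := ltn_ord i; case: (0 < u 0 i); lia.
Qed.

(** Vectors labelled [+ i] and [- i] have [i]-th coordinates of opposite sign and absolute value at
    least [r], so they differ there by at least [2r > D]. *)
Lemma complement_free_label (r D : R) s : (0 < n)%N -> 0 < r -> D < r ->
  (forall u, u \in s -> bounded_below r u) -> spread D s ->
  complement_free (map label s).
Proof.
move=> n0 r0 Dr sr sD a /mapP[u us ->]; apply/negP => /mapP[v vs].
have [i ui ->] := label_spec u n0; have [j vj ->] := label_spec v n0.
rewrite /flip oddD odd_double addFb oddb => E.
have ij : i = j.
  by apply: val_inj; move: E; case: (0 < u 0 i); case: (0 < v 0 j) => /=; lia.
rewrite -{j}ij in vj E; have := sD u v us vs i.
have := bounded_below_max (sr _ us) ui; have := bounded_below_max (sr _ vs) vj.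
move: E; case: (ltP 0 (u 0 i)) => ui0; case: (ltP 0 (v 0 i)) => vi0 /=; try lia.
  by move=> _; rewrite ler_norml (gtr0_norm ui0) (ler0_norm vi0); lra.
by move=> _; rewrite ler_norml (gtr0_norm vi0) (ler0_norm ui0); lra.
Qed.

Definition theta s : bool := kyfan true (map label s).

Lemma theta_cob (r D : R) s : (0 < n)%N -> 0 < r -> D < r -> s != [::] ->
  (forall u, u \in s -> bounded_below r u) -> spread D s ->
  cob (@faces _) theta s = theta s (+) theta (map (fun u => - u) s).
Proof.
move=> n0 r0 Dr s0 sr sD.
have := @cob_faces_map _ _ label (kyfan true) s; rewrite /theta => <-.
rewrite cob_kyfan; last by rewrite -size_eq0 size_map size_eq0.
congr addb; rewrite -(@kyfan_flip true); last exact: (complement_free_label n0 r0 Dr).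
congr kyfan; rewrite -!map_comp; apply/eq_in_map => u us /=.
by rewrite (label_opp n0 r0) //; apply: sr.
Qed.

Lemma theta_top (r D : R) s : (0 < n)%N -> 0 < r -> D < r -> (n < size s)%N ->
  (forall u, u \in s -> bounded_below r u) -> spread D s -> theta s = false.
Proof.
move=> n0 r0 Dr ns sr sD; apply: (@kyfan_top true n).
- exact: (complement_free_label n0 r0 Dr).
- by apply/allP => a /mapP[u _ ->]; apply: label_lt.
- by rewrite size_map.
Qed.

End Hull.

(** * The deleted product of a skeleton *)

(** Off-diagonal terms cancel in pairs mod 2. *)
Lemma addb_sum_sym (I : Type) (s : seq I) (G : I -> I -> bool) :
  (forall i j, G i j = G j i) ->
  \big[addb/false]_(i <- s) \big[addb/false]_(j <- s) G i j =
  \big[addb/false]_(i <- s) G i i.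
Proof.
move=> Gsym; elim: s => [|x s IHs]; first by rewrite !big_nil.
rewrite !big_cons -IHs.
have -> : \big[addb/false]_(i <- s) \big[addb/false]_(j <- x :: s) G i j =
    \big[addb/false]_(i <- s) G x i (+)
    \big[addb/false]_(i <- s) \big[addb/false]_(j <- s) G i j.
  by rewrite -big_split; apply: eq_bigr => i _; rewrite big_cons Gsym.
by rewrite -addbA [X in _ (+) X]addbA addbb.
Qed.

Section Cells.
Variable I : finType.
Local Notation cell := ({set I} * {set I})%type.
Implicit Types (e : cell) (s t : {set I}) (psi : cell -> bool).

Definition swap e : cell := (e.2, e.1).

(* The cell [(set0, set0)] is the augmentation; no other cell with an empty
   factor belongs to the deleted product. *)
Definition cell_faces e : seq cell :=
  [seq (e.1 :\ i, e.2) | i <- enum e.1 & (1 < #|e.1|)%N] ++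
  [seq (e.1, e.2 :\ j) | j <- enum e.2 & (1 < #|e.2|)%N] ++
  (if (#|e.1| == 1%N) && (#|e.2| == 1%N) then [:: (set0, set0)] else [::]).

Lemma cob_cell psi e : cob cell_faces psi e =
  \big[addb/false]_(i in e.1 | (1 < #|e.1|)%N) psi (e.1 :\ i, e.2) (+)
  (\big[addb/false]_(j in e.2 | (1 < #|e.2|)%N) psi (e.1, e.2 :\ j) (+)
  ((#|e.1| == 1%N) && (#|e.2| == 1%N) && psi (set0, set0))).
Proof.
rewrite /cob /cell_faces !big_cat !big_map !big_filter /=.
rewrite !big_enum_cond /=; congr (_ (+) (_ (+) _)).
  by case: andP => _; rewrite ?big_seq1 ?big_nil.
Qed.

Lemma addb_sum_setD1 s (G : {set I} -> bool) :
  \big[addb/false]_(i in s) \big[addb/false]_(j in s :\ i) G (s :\ i :\ j) = false.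
Proof.
pose G' i j := [&& i \in s, j \in s, i != j & G (s :\ i :\ j)].
transitivity (\big[addb/false]_i \big[addb/false]_j G' i j).
  rewrite big_mkcond; apply: eq_bigr => i _; rewrite /G'.
  case: ifP => [is_|_]; last by rewrite big1.
  rewrite big_mkcond; apply: eq_bigr => j _.
  by rewrite in_setD1 eq_sym; case: (i != j); case: (j \in s).
rewrite addb_sum_sym => [|i j]; first by rewrite big1 // => i _; rewrite /G' eqxx !andbF.
rewrite /G' eq_sym setDDl [in RHS]setDDl setUC.
by case: (i \in s); case: (j \in s).
Qed.

(** Two deletions in the same factor cancel by [addb_sum_setD1]; one deletion in each factor occurs
    in both orders, giving [mixed] twice. The augmentation is reached from sizes (2,1) and (1,2),
    each time through two vertices. *)
Lemma cob_cellK psi e : cob cell_faces (cob cell_faces psi) e = false.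
Proof.
case: e => s t; rewrite cob_cell /=.
have -> : cob cell_faces psi (set0, set0) = false.
  rewrite cob_cell /= cards0 !big1 => [//|i|i]; by rewrite in_set0.
rewrite andbF addbF.
set c := (#|s| == 2%N) && (#|t| == 1%N) && psi (set0, set0).
have D1 (r : {set I}) i : i \in r -> #|r| = #|r :\ i|.+1.
  by move=> ir; rewrite (cardsD1 i r) ir.
pose mixed := \big[addb/false]_(i in s | (1 < #|s|)%N)
    \big[addb/false]_(j in t | (1 < #|t|)%N) psi (s :\ i, t :\ j).
have -> : \big[addb/false]_(i in s | (1 < #|s|)%N)
    cob cell_faces psi (s :\ i, t) = mixed.
  rewrite (eq_bigr _ (fun i _ => cob_cell psi (s :\ i, t))) /= !big_split /=.
  rewrite [X in X (+) _](_ : _ = false); last first.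
    case: (ltnP 2 #|s|) => s2; last first.
      rewrite big1 // => i /andP[is_ _]; rewrite big1 // => j.
      by move: s2; rewrite (D1 s i) // => s2; case/andP => _; lia.
    rewrite -[RHS](addb_sum_setD1 s (fun r => psi (r, t))).
    apply: eq_big => i; first by rewrite (ltnW s2) andbT.
    case/andP => is_ _; apply: eq_bigl => j.
    by move: s2; rewrite (D1 s i) // ltnS => ->; rewrite andbT.
  rewrite [X in _ (+) (_ (+) X)](_ : _ = false) ?addbF //.
  case: (boolP c) => [/andP[/andP[s2 t1] p0]|c0].
    rewrite (eq_bigl (mem s)) => [|i]; last by rewrite (eqP s2) andbT.
    rewrite (eq_bigr (fun=> true)) => [|i is_]; last first.
      by move: s2; rewrite (D1 s i) // eqSS => ->; rewrite t1 p0.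
    by rewrite big_const (eqP s2).
  rewrite big1 // => i /andP[is_ _]; apply: contraNF c0.
  by rewrite /c (D1 s i) // eqSS.
have -> : \big[addb/false]_(j in t | (1 < #|t|)%N)
    cob cell_faces psi (s, t :\ j) = mixed; last by rewrite addbb.
rewrite (eq_bigr _ (fun j _ => cob_cell psi (s, t :\ j))) /= !big_split /=.
rewrite [X in _ (+) (X (+) _)](_ : _ = false); last first.
  case: (ltnP 2 #|t|) => t2; last first.
    rewrite big1 // => i /andP[it _]; rewrite big1 // => j.
    by move: t2; rewrite (D1 t i) // => t2; case/andP => _; lia.
  rewrite -[RHS](addb_sum_setD1 t (fun r => psi (s, r))).
  apply: eq_big => i; first by rewrite (ltnW t2) andbT.
  case/andP => it _; apply: eq_bigl => j.
  by move: t2; rewrite (D1 t i) // ltnS => ->; rewrite andbT.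
rewrite [X in _ (+) (_ (+) X)](_ : _ = false).
  by rewrite /mixed !addbF exchange_big.
case: (boolP ((#|s| == 1%N) && (#|t| == 2%N) && psi (set0, set0))) =>
    [/andP[/andP[s1 t2] p0]|c0].
  rewrite (eq_bigl (mem t)) => [|i]; last by rewrite (eqP t2) andbT.
  rewrite (eq_bigr (fun=> true)) => [|i it]; last first.
    by move: t2; rewrite (D1 t i) // eqSS => ->; rewrite s1 p0.
  by rewrite big_const (eqP t2).
rewrite big1 // => i /andP[it _]; apply: contraNF c0.
by rewrite (D1 t i) // eqSS.
Qed.

Lemma cob_cell_swap psi e :
  cob cell_faces psi (swap e) = cob cell_faces (fun x => psi (swap x)) e.
Proof.
rewrite !cob_cell /swap /= [in RHS](addbC (\big[_/_]_(i in e.1 | _) _)) -addbA.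
by congr addb; rewrite addbC (andbC (#|e.1| == 1%N)).
Qed.

(** * The van Kampen-Flores count *)

(** Double counting: each face is weighted by the parity of the number of cells in [P] having it as
    a face. *)
Lemma addb_sum_setU1_l (P : pred cell) (X : cell -> bool) :
  \big[addb/false]_(e : cell | P e) \big[addb/false]_(i in e.1) X (e.1 :\ i, e.2) =
  \big[addb/false]_(e : cell)
    (\big[addb/false]_(i | (i \notin e.1) && P (i |: e.1, e.2)) true && X e).
Proof.
transitivity (\big[addb/false]_i \big[addb/false]_(e : cell | P e && (i \in e.1))
    X (e.1 :\ i, e.2)).
  by rewrite (exchange_big_dep predT).
transitivity (\big[addb/false]_i \big[addb/false]_(e : cell)
    ((i \notin e.1) && P (i |: e.1, e.2) && X e)).
  apply: eq_bigr => i _.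
  rewrite (reindex_onto (fun e : cell => (i |: e.1, e.2))
                        (fun e : cell => (e.1 :\ i, e.2))) /=; last first.
    by case=> s t /andP[_ /= is_]; rewrite setD1K.
  rewrite big_mkcond; apply: eq_bigr => -[s t] _ /=.
  rewrite setU11 andbT xpair_eqE eqxx andbT.
  have -> : ((i |: s) :\ i == s) = (i \notin s).
    apply/eqP/idP => [<-|/setU1K//]; by rewrite setD11.
  by case: (boolP (i \notin s)) => [/setU1K ->|]; case: (P _).
rewrite exchange_big; apply: eq_bigr => e _.
rewrite [X in X && _]big_mkcond /= big_distrl /=.
by apply: eq_bigr => i _; case: ifP.
Qed.

Lemma big_swap (P : pred cell) (X : cell -> bool) :
  \big[addb/false]_(e : cell | P e) X e =
  \big[addb/false]_(e : cell | P (swap e)) X (swap e).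
Proof. by apply: reindex; exists swap => -[]. Qed.

Lemma addb_sum_setU1_r (P : pred cell) (X : cell -> bool) :
  \big[addb/false]_(e : cell | P e) \big[addb/false]_(j in e.2) X (e.1, e.2 :\ j) =
  \big[addb/false]_(e : cell)
    (\big[addb/false]_(j | (j \notin e.2) && P (e.1, j |: e.2)) true && X e).
Proof.
by rewrite big_swap (addb_sum_setU1_l (fun e => P (swap e)) (fun e => X (swap e)))
  [RHS]big_swap.
Qed.

Definition typed (a b : nat) (W : {set I}) : pred cell := fun e =>
  [&& e.1 \subset W, e.2 \subset W, [disjoint e.1 & e.2], #|e.1| == a & #|e.2| == b].

Lemma typed_swap a b W e : typed a b W (swap e) = typed b a W e.
Proof.
rewrite /typed /= disjoint_sym.
by case: (e.1 \subset W); case: (e.2 \subset W) => //=; rewrite (andbC (_ == a)).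
Qed.

Lemma typed_setU1 a b (W : {set I}) s t i :
  (i \notin s) && typed a.+1 b W (i |: s, t) =
  typed a b W (s, t) && (i \in W :\: (s :|: t)).
Proof.
rewrite /typed /= in_setD in_setU negb_or subUset sub1set cardsU1.
have -> : [disjoint i |: s & t] = (i \notin t) && [disjoint s & t].
  by rewrite -[LHS]setI_eq0 setIUl setU_eq0 !setI_eq0 disjoints1.
case: (i \notin s) => /=; last by rewrite andbF.
rewrite add1n eqSS; case: (i \notin t) => /=; last by rewrite !andbF.
by case: (i \in W) => //=; rewrite ?andbT ?andbF.
Qed.

(** The last clause says that [s], [t], [x], [y] partition [W], in a form suited to a boolean case
    split. *)
Lemma typed_missing a b (W : {set I}) s t : typed a b W (s, t) -> #|W| = (a + b).+2 ->
  exists x y, [/\ x != y, W :\: (s :|: t) = [set x; y] &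
  forall z, z \in W -> ((z \in s) + (z \in t) + (z == x) + (z == y) == 1)%N].
Proof.
rewrite /typed /= -setI_eq0 => /and5P[sW tW /eqP st /eqP sa /eqP tb] W2.
have : #|W :\: (s :|: t)| == 2.
  rewrite cardsD (setIidPr _); last by rewrite subUset sW.
  by rewrite cardsU st cards0 sa tb W2; lia.
case/cards2P => x [y [xy E]]; exists x, y; split=> // z zW.
have : (z \in W :\: (s :|: t)) = (z == x) || (z == y) by rewrite E !inE.
have : ~~ ((z \in s) && (z \in t)) by rewrite -in_setI st in_set0.
have : ~~ ((z == x) && (z == y)).
  by apply: contra xy => /andP[/eqP <- /eqP <-].
rewrite in_setD in_setU zW.
by case: (z \in s); case: (z \in t); case: (z == x); case: (z == y).
Qed.

Lemma addb_sum_typed a b (W : {set I}) s t (g : pred cell) : #|W| = (a + b).+2 ->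
  \big[addb/false]_(i | (i \notin s) &&
      (typed a.+1 b W (i |: s, t) && g (i |: s, t))) true =
  typed a b W (s, t) &&
  \big[addb/false]_(i in W :\: (s :|: t)) g (i |: s, t).
Proof.
move=> W2; case: (boolP (typed a b W (s, t))) => T /=; last first.
  by rewrite big_pred0 // => i; rewrite andbA typed_setU1 (negPf T).
rewrite [RHS]big_mkcond [LHS]big_mkcond; apply: eq_bigr => i _.
by rewrite andbA typed_setU1 T /=; case: (i \in _) => //=; case: (g _).
Qed.

Lemma addb_sum2 (x y : I) (g : pred I) : x != y ->
  \big[addb/false]_(i in [set x; y]) g i = g x (+) g y.
Proof. by move=> xy; rewrite big_setU1 ?big_set1 // in_set1. Qed.

Section Step.
Variables (k : nat) (W : {set I}) (x0 x1 : I).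
Hypotheses (x0W : x0 \in W) (x1W : x1 \in W) (x01 : x0 != x1).
Hypothesis cardW : #|W| = (k.+1 * 2).+1.

(* Exactly one of [e] and [swap e] is positive, since at most one of [x0] and
   [x1] is missing from a cell of type [(k+1, k+1)]. *)
Definition positive e : bool :=
  (x0 \in e.1) || ((x0 \notin e.2) && (x1 \in e.1)).

Lemma positive_swap e : typed k.+1 k.+1 W e -> positive (swap e) = ~~ positive e.
Proof.
case: e => s t; rewrite /typed /positive /= -setI_eq0 => /and5P[sW tW /eqP st /eqP sa /eqP tb].
have st0 z : ~~ ((z \in s) && (z \in t)) by rewrite -in_setI st in_set0.
have D1 : #|W :\: (s :|: t)| = 1%N.
  rewrite cardsD (setIidPr _); last by rewrite subUset sW.
  by rewrite cardsU st cards0 sa tb cardW; lia.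
have : ~~ ((x0 \in W :\: (s :|: t)) && (x1 \in W :\: (s :|: t))).
  have /cards1P[z ->] : #|W :\: (s :|: t)| == 1%N by rewrite D1.
  by rewrite !in_set1; apply: contra x01 => /andP[/eqP -> /eqP ->].
rewrite !in_setD !in_setU x0W x1W; move: (st0 x0) (st0 x1).
by case: (x0 \in s); case: (x0 \in t); case: (x1 \in s); case: (x1 \in t).
Qed.

(** Two vertices of [W] are missing from [(s, t)]. If [x0] lies in [s], both extensions are
    positive; if in [t], none. If [x0] is missing, the extension by [x0] is positive, and the other
    one is so unless [x1] lies in [t]. *)
Lemma positive_extend_l s t :
  \big[addb/false]_(i | (i \notin s) &&
    (typed k.+1 k.+1 W (i |: s, t) && positive (i |: s, t))) true =
  typed k k.+1 (W :\ x0) (s, t) && (x1 \in t).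
Proof.
have cW : #|W| = (k + k.+1).+2 by rewrite cardW; lia.
rewrite addb_sum_typed //.
rewrite /typed /= !subsetD1.
case: (boolP (typed k k.+1 W (s, t))) => T; last first.
  by move: T; rewrite /typed /=; do 2!case: (_ \subset W) => //=;
    move=> /negPf E; rewrite ?E ?andbF //; case: (x0 \in s); rewrite ?E //=;
    case: (x0 \in t); rewrite ?E.
have [x [y [xy -> one]]] := typed_missing T cW.
rewrite addb_sum2 //; move: T; rewrite /typed /= => /and5P[-> -> -> -> ->] /=.
move: (one _ x0W) (one _ x1W); rewrite /positive /= !in_setU1.
have: ~~ ((x0 == x) && (x1 == x)) by apply: contra x01 => /andP[/eqP -> /eqP ->].
have: ~~ ((x0 == y) && (x1 == y)) by apply: contra x01 => /andP[/eqP -> /eqP ->].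
case: (x0 \in s); case: (x0 \in t); case: (x0 == x); case: (x0 == y);
  rewrite ?andbF ?andbT //=;
by case: (x1 \in s); case: (x1 \in t); case: (x1 == x); case: (x1 == y).
Qed.

(** Swapping the factors negates [positive], but there are two extensions, so the negations cancel
    and [positive_extend_l] applies. *)
Lemma positive_extend_r s t :
  \big[addb/false]_(j | (j \notin t) &&
    (typed k.+1 k.+1 W (s, j |: t) && positive (s, j |: t))) true =
  typed k.+1 k (W :\ x0) (s, t) && (x1 \in s).
Proof.
have cW : #|W| = (k + k.+1).+2 by rewrite cardW; lia.
rewrite -(typed_swap k k.+1 _ (s, t)) -[swap _]/(t, s) -(positive_extend_l t s).
transitivity (\big[addb/false]_(j | (j \notin t) &&
    (typed k.+1 k.+1 W (j |: t, s) && (predC positive) (j |: t, s))) true).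
  apply: eq_bigl => j; congr andb.
  rewrite -[(s, _)]/(swap (j |: t, s)) typed_swap.
  by case: (boolP (typed _ _ _ _)) => //= T; rewrite positive_swap.
rewrite !addb_sum_typed //; case: (boolP (typed _ _ _ _)) => //= T.
have [x [y [xy -> _]]] := typed_missing T cW.
by rewrite !addb_sum2 //=; case: (positive _); case: (positive _).
Qed.

Lemma card_setD1W : #|W :\ x0| = (k + k).+2.
Proof. by have := cardsD1 x0 W; rewrite x0W cardW; lia. Qed.

(** Of the two extensions, both contain [x1] if it lies in [s], none if it lies in [t], and exactly
    one if it is missing. *)
Lemma member_extend_l s t :
  \big[addb/false]_(i | (i \notin s) &&
    (typed k.+1 k (W :\ x0) (i |: s, t) && (x1 \in i |: s))) true =
  typed k k (W :\ x0 :\ x1) (s, t).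
Proof.
have x1W0 : x1 \in W :\ x0 by rewrite !inE eq_sym x01.
rewrite (@addb_sum_typed k k _ s t (fun e => x1 \in e.1)) ?card_setD1W //.
rewrite [RHS]/typed /= !(subsetD1 _ _ x1).
case: (boolP (typed k k (W :\ x0) (s, t))) => T; last first.
  by move: T; rewrite /typed /=; do 2!case: (_ \subset _) => //=;
    move=> /negPf E; rewrite ?E ?andbF //; case: (x1 \in s); rewrite ?E //=;
    case: (x1 \in t); rewrite ?E.
have [x [y [xy -> one]]] := typed_missing T card_setD1W.
rewrite addb_sum2 //; move: T; rewrite /typed /= => /and5P[-> -> -> -> ->] /=.
move: (one _ x1W0); rewrite !in_setU1.
by case: (x1 \in s); case: (x1 \in t); case: (x1 == x); case: (x1 == y).
Qed.

(** The condition on [x1] does not involve [j], and there are two choices of [j]. *)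
Lemma member_extend_r s t : (0 < k)%N ->
  \big[addb/false]_(j | (j \notin t) &&
    (typed k.+1 k (W :\ x0) (s, j |: t) && (x1 \in s))) true = false.
Proof.
move=> k0; have cW : #|W :\ x0| = (k.-1 + k.+1).+2 by rewrite card_setD1W; lia.
transitivity (\big[addb/false]_(j | (j \notin t) &&
    (typed k.-1.+1 k.+1 (W :\ x0) (j |: t, s) && (x1 \in (j |: t, s).2))) true).
  apply: eq_bigl => j; congr (_ && (_ && _)).
  by rewrite -[(s, _)]/(swap (j |: t, s)) typed_swap prednK.
rewrite (@addb_sum_typed k.-1 k.+1 _ t s (fun e => x1 \in e.2)) //.
case: (boolP (typed _ _ _ _)) => //= T.
have [x [y [xy -> _]]] := typed_missing T cW.
by rewrite addb_sum2 //= addbb.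
Qed.

Variables (D : nat) (X : cell -> bool).
Hypothesis kD : (k < D)%N.
Hypothesis XD : forall e, [disjoint e.1 & e.2] ->
  (0 < #|e.1| <= D)%N -> (0 < #|e.2| <= D)%N ->
  X e (+) X (swap e) = cob cell_faces X e.

Lemma typed_sum_positive :
  \big[addb/false]_(e : cell | typed k.+1 k.+1 W e) X e =
  \big[addb/false]_(e : cell | typed k.+1 k.+1 W e && positive e)
    cob cell_faces X e.
Proof.
rewrite (bigID positive) /= [X in _ (+) X]big_swap.
rewrite [X in _ (+) X](eq_bigl (fun e => typed k.+1 k.+1 W e && positive e)).
  rewrite -big_split /=; apply: eq_bigr => e /andP[/and5P[_ _ est /eqP es /eqP et] _].
  by apply: XD; rewrite ?es ?et.
move=> e; rewrite typed_swap; case: (boolP (typed _ _ _ _)) => //= T.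
by rewrite positive_swap ?negbK.
Qed.

(** First descent. The faces of odd weight form two families, of types [(k, k+1)] and [(k+1, k)],
    exchanged by [swap]; hence the relation [XD] applies a second time. *)
Lemma typed_sum_top : (0 < k)%N ->
  \big[addb/false]_(e : cell | typed k.+1 k.+1 W e) X e =
  \big[addb/false]_(e : cell | typed k.+1 k (W :\ x0) e && (x1 \in e.1))
    cob cell_faces X e.
Proof.
move=> k0; rewrite typed_sum_positive.
transitivity (\big[addb/false]_(e : cell | typed k.+1 k.+1 W e && positive e)
   \big[addb/false]_(i in e.1) X (e.1 :\ i, e.2) (+)
   \big[addb/false]_(e : cell | typed k.+1 k.+1 W e && positive e)
   \big[addb/false]_(j in e.2) X (e.1, e.2 :\ j)).
  rewrite -big_split /=; apply: eq_bigr => e /andP[/and5P[_ _ _ /eqP es /eqP et] _].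
  rewrite cob_cell es et !eqSS (gtn_eqF k0) addbF ltnS k0.
  by congr addb; apply: eq_bigl => i; rewrite andbT.
rewrite addb_sum_setU1_l addb_sum_setU1_r.
rewrite [X in X (+) _](eq_bigr (fun e => typed k k.+1 (W :\ x0) e && (x1 \in e.2) && X e));
  last by case=> s t _; rewrite /= positive_extend_l.
rewrite [X in _ (+) X](eq_bigr (fun e => typed k.+1 k (W :\ x0) e && (x1 \in e.1) && X e));
  last by case=> s t _; rewrite /= positive_extend_r.
rewrite [X in X (+) _]big_swap -big_split /=.
rewrite [RHS]big_mkcond; apply: eq_bigr => e _; rewrite typed_swap.
case: (boolP (typed _ _ _ _)) => //= /and5P[_ _ est /eqP es /eqP et].
case: (x1 \in e.1) => //=; rewrite addbC; apply: XD; rewrite ?es ?et ?k0 //=.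
exact: ltnW.
Qed.

(** Second descent: faces of type [(k, k)] survive exactly when they avoid [x0] and [x1], and those
    of type [(k+1, k-1)] cancel. *)
Lemma typed_sum_step : (0 < k)%N ->
  \big[addb/false]_(e : cell | typed k.+1 k.+1 W e) X e =
  \big[addb/false]_(e : cell | typed k k (W :\ x0 :\ x1) e) X e.
Proof.
move=> k0; rewrite typed_sum_top //.
pose Q e := typed k.+1 k (W :\ x0) e && (x1 \in e.1).
(* The guard [1 < k] is there because [cell_faces] never deletes the only vertex of a factor. *)
transitivity (\big[addb/false]_(e : cell | Q e)
   \big[addb/false]_(i in e.1) X (e.1 :\ i, e.2) (+)
   \big[addb/false]_(e : cell | Q e)
   \big[addb/false]_(j in e.2) ((1 < k)%N && X (e.1, e.2 :\ j))).
  rewrite -big_split /=; apply: eq_bigr => e /andP[/and5P[_ _ _ /eqP es /eqP et] _].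
  rewrite cob_cell es et !eqSS (gtn_eqF k0) addbF ltnS k0.
  congr addb; first by apply: eq_bigl => i; rewrite andbT.
  by case: (1 < k)%N; [apply: eq_bigl => i; rewrite andbT|rewrite !big1 // => i; rewrite andbF].
rewrite addb_sum_setU1_l.
rewrite [X in X (+) _](eq_bigr (fun e => typed k k (W :\ x0 :\ x1) e && X e));
  last by case=> s t _; rewrite /= member_extend_l.
rewrite [X in _ (+) X](_ : _ = false); last first.
  case: (1 < k)%N; last by rewrite big1 // => e _; rewrite big1.
  rewrite addb_sum_setU1_r big1 // => -[s t] _ /=.
  by rewrite member_extend_r.
rewrite addbF [RHS]big_mkcond; apply: eq_bigr => e _.
by case: (typed _ _ _ _).
Qed.

(** Every cell now is a pair of vertices with coboundary [X (set0, set0)], so it remains to see that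
    the number of positive cells is odd. *)
Lemma typed_sum_base : k = 0%N ->
  \big[addb/false]_(e : cell | typed k.+1 k.+1 W e) X e = X (set0, set0).
Proof.
move=> k0; rewrite typed_sum_positive.
(* The sum over the single vertex of [e.1] is artificial: it brings in the double count, where only
   [(set0, [set x1])] has odd weight. *)
transitivity (\big[addb/false]_(e : cell | typed k.+1 k.+1 W e && positive e)
   \big[addb/false]_(i in e.1) X (set0, set0)).
  apply: eq_bigr => e /andP[/and5P[_ _ _ /eqP es /eqP et] _].
  rewrite cob_cell es et k0 /= [X in X (+) _]big1; last by move=> i; rewrite andbF.
  rewrite [X in _ (+) (X (+) _)]big1; last by move=> i; rewrite andbF.
  by rewrite big_const es k0 /= addbF.
rewrite (addb_sum_setU1_l _ (fun=> X (set0, set0))).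
rewrite (eq_bigr (fun e => (e == (set0, [set x1])) && X (set0, set0))).
  rewrite (bigD1 (set0, [set x1])) //= eqxx big1 ?addbF // => e /negPf ->.
  by [].
case=> s t _; rewrite /= positive_extend_l; congr andb.
rewrite /typed /= k0 cards_eq0 xpair_eqE; case: (boolP (s == set0)) => [/eqP ->|_].
  rewrite sub0set disjoint_sym -setI_eq0 setI0 eqxx /=.
  apply/andP/eqP => [[/andP[_ /cards1P[x ->]]]|->].
    by rewrite in_set1 => /eqP ->.
  by rewrite sub1set !inE eq_sym x01 x1W cards1 eqxx.
by rewrite /= !andbF.
Qed.

End Step.

Lemma typed_sum (D : nat) (X : cell -> bool) :
  (forall e, [disjoint e.1 & e.2] -> (0 < #|e.1| <= D)%N -> (0 < #|e.2| <= D)%N ->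
     X e (+) X (swap e) = cob cell_faces X e) ->
  forall k (W : {set I}), (k < D)%N -> #|W| = (k.+1 * 2).+1 ->
  \big[addb/false]_(e : cell | typed k.+1 k.+1 W e) X e = X (set0, set0).
Proof.
move=> XD k; elim: k => [|k IHk] W kD cardW.
all: have [x0 x0W] : exists x, x \in W by apply/card_gt0P; rewrite cardW.
all: have c0 := cardsD1 x0 W; rewrite x0W cardW in c0.
all: have [x1 x1W0] : exists x, x \in W :\ x0 by apply/card_gt0P; lia.
all: have c1 := cardsD1 x1 (W :\ x0); rewrite x1W0 in c1.
all: move: x1W0; rewrite !inE => /andP[x10 x1W].
all: have x01 : x0 != x1 by rewrite eq_sym.
  exact: (typed_sum_base x0W x1W x01 cardW kD XD).
rewrite (typed_sum_step x0W x1W x01 cardW kD XD) //.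
by apply: IHk; [apply: ltnW|lia].
Qed.

End Cells.

(** * Cells as compact convex sets *)

Section LebesgueNumber.
Local Open Scope classical_set_scope.

(** Stated for a relation on pairs since [P_f] need not be continuous: admissibility only controls
    pairs of points near a given one. *)
Lemma lebesgue_number (R : realType) (p : nat) (K : set 'rV[R]_p)
    (Q : 'rV[R]_p -> 'rV[R]_p -> Prop) :
  compact K ->
  (forall z, K z -> exists2 e : R, 0 < e & forall z1 z2, K z1 -> K z2 ->
     (forall i, `|z1 0 i - z 0 i| < e) -> (forall i, `|z2 0 i - z 0 i| < e) ->
     Q z1 z2) ->
  exists2 e : R, 0 < e & forall z1 z2, K z1 -> K z2 ->
     (forall i, `|z1 0 i - z2 0 i| < e) -> Q z1 z2.
Proof.
move=> /compact_near_coveringP cK KQ.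
pose P (e : R) z1 := forall z2, K z1 -> K z2 ->
  (forall i, `|z1 0 i - z2 0 i| < e) -> Q z1 z2.
have : \forall e \near 0^'+, K `<=` P e.
  apply: cK => z Kz; have [e e0 zQ] := KQ z Kz.
  (* Half the radius is for [z1], the other half for the distance from [z1] to [z2]. *)
  have e2 : 0 < e / 2 by rewrite divr_gt0.
  exists (ball z (e / 2), [set d | 0 < d < e / 2]).
    split; first exact: nbhsx_ballx.
    by near=> d; apply/andP; split; near: d; [exact: nbhs_right_gt|exact: nbhs_right_lt].
  case=> z1 d [/= zz1 /andP[_ de]] z2 K1 K2 z12.
  have zz1' i : `|z1 0 i - z 0 i| < e / 2 by rewrite distrC; case: zz1 => _; apply.
  apply: zQ => // i; first by have := zz1' i; lra.
  have := zz1' i; have := z12 i; rewrite !ltr_norml => /andP[? ?] /andP[? ?].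
  by apply/andP; split; lra.
move=> near0.
have : \forall e \near (0 : R)^'+, 0 < e /\ K `<=` P e.
  by near=> e; split; near: e => //; exact: nbhs_right_gt.
move=> /filter_ex[e [e0 KP]]; exists e => // z1 z2 K1 K2.
exact: KP.
Unshelve. all: by end_near.
Qed.

End LebesgueNumber.

Section Geometry.
Local Open Scope classical_set_scope.
Variables (R : realType) (d : nat).
Local Notation N := (2 * d + 3)%N.
Local Notation cell := ({set 'I_N} * {set 'I_N})%type.
Implicit Types (z : 'rV[R]_(N + N)) (e : cell).

(** A pair of points is a single row vector, so that product cells can be subdivided in one vector
    space. *)
Definition lft z : pt R d := fun i => lsubmx z 0 i.
Definition rgt z : pt R d := fun i => rsubmx z 0 i.

Definition swapz z : 'rV[R]_(N + N) := row_mx (rsubmx z) (lsubmx z).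

Lemma lft_swapz z : lft (swapz z) = rgt z.
Proof. by rewrite /lft /swapz row_mxKl. Qed.

Lemma rgt_swapz z : rgt (swapz z) = lft z.
Proof. by rewrite /rgt /swapz row_mxKr. Qed.

Definition incell e z : Prop := in_face (lft z) e.1 /\ in_face (rgt z) e.2.

Definition face_barycenter (s : {set 'I_N}) : 'rV[R]_N :=
  \row_i ((i \in s)%:R / #|s|%:R).

Definition cell_barycenter e : 'rV[R]_(N + N) :=
  row_mx (face_barycenter e.1) (face_barycenter e.2).

Lemma cell_barycenter_swap e : cell_barycenter (swap e) = swapz (cell_barycenter e).
Proof. by rewrite /swapz /cell_barycenter row_mxKl row_mxKr. Qed.

Lemma in_face_barycenter s : s != set0 -> in_face (fun i => face_barycenter s 0 i) s.
Proof.
move=> s0; have sn0 : #|s|%:R != 0 :> R by rewrite pnatr_eq0 cards_eq0.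
split=> [i|]; first by rewrite mxE divr_ge0 ?ler0n.
split=> [|i /negPf ins]; last by rewrite mxE ins mul0r.
under eq_bigr => i _ do rewrite mxE.
rewrite -mulr_suml.
have -> : \sum_i (i \in s)%:R = #|s|%:R :> R.
  rewrite -sum1_card natr_sum [RHS]big_mkcond.
  by apply: eq_bigr => i _; case: (i \in s).
by rewrite divff.
Qed.

Lemma incell_barycenter e : e.1 != set0 -> e.2 != set0 -> incell e (cell_barycenter e).
Proof.
by move=> e1 e2; split; rewrite /lft /rgt ?row_mxKl ?row_mxKr; apply: in_face_barycenter.
Qed.

Lemma in_face_sub (x : pt R d) (s s' : {set 'I_N}) :
  s' \subset s -> in_face x s' -> in_face x s.
Proof.
move=> ss [x0 [x1 xs]]; split=> //; split=> // i ins.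
by apply: xs; apply: contra ins; apply: (fintype.subsetP ss).
Qed.

Lemma in_face_le1 (x : pt R d) (s : {set 'I_N}) i : in_face x s -> 0 <= x i <= 1.
Proof.
case=> x0 [x1 _]; rewrite x0 -x1 (bigD1 i) //= lerDl.
by apply: sumr_ge0.
Qed.

Lemma in_face_bary_closed (s : {set 'I_N}) (h : 'rV[R]_(N + N) -> pt R d) :
  (forall z w i, h (z + w) i = h z i + h w i) ->
  (forall a z i, h (a *: z) i = a * h z i) ->
  bary_closed (fun z => in_face (h z) s).
Proof.
move=> hD hZ; apply: bary_closed_and; first by
  apply: bary_closed_forall => i; apply: bary_closed_ge.
have eqc (l : 'rV[R]_(N + N) -> R) c : (forall x y, l (x + y) = l x + l y) ->
    (forall a x, l (a *: x) = a * l x) -> bary_closed (fun z => l z = c).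
  move=> lD lZ t t0 tc; apply/eqP; rewrite eq_le.
  rewrite (bary_closed_le lD lZ t0) ?(bary_closed_ge lD lZ t0) // => x /tc -> //.
apply: bary_closed_and.
  apply: eqc => [x y|a x]; first by rewrite -big_split; apply: eq_bigr.
  by rewrite mulr_sumr; apply: eq_bigr.
apply: bary_closed_forall => i t t0 tc is_.
by apply: (eqc (fun z => h z i)) => // x xt; apply: tc.
Qed.

Lemma incell_bary_closed e : bary_closed (incell e).
Proof.
by apply: bary_closed_and; apply: in_face_bary_closed => *; rewrite /lft /rgt !mxE.
Qed.

Lemma in_face_closed (s : {set 'I_N}) (h : 'I_N -> 'I_(N + N)) :
  closed [set z : 'rV[R]_(N + N) | in_face (fun i => z 0 (h i)) s].
Proof.
have cont i : continuous (fun z : 'rV[R]_(N + N) => z 0 (h i)).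
  exact: coord_continuous.
have -> : [set z : 'rV[R]_(N + N) | in_face (fun i => z 0 (h i)) s] =
    (\bigcap_(i in classical_sets.setT) [set z | 0 <= z 0 (h i)]) `&`
    ([set z | \sum_i z 0 (h i) = 1] `&`
    \bigcap_(i in [set i | i \notin s]) [set z | z 0 (h i) = 0]).
  apply/seteqP; split => z [z0 [z1 zs]].
    by split=> [i _|]; [exact: z0|split=> // i; exact: zs].
  split=> [i|]; first exact: z0.
  by split=> // i; exact: zs.
apply: closedI.
  apply: closed_bigI => i _.
  by apply: (@preimage_closed _ _ (fun z : 'rV[R]_(N + N) => z 0 (h i))
    [set x | 0 <= x]) => // z _;
    exact: cont.
apply: closedI; last first.
  apply: closed_bigI => i _.
  by apply: (@preimage_closed _ _ (fun z : 'rV[R]_(N + N) => z 0 (h i))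
    [set x | x = 0]) => // z _;
    exact: cont.
apply: (@preimage_closed _ _ (fun z : 'rV[R]_(N + N) => \sum_i z 0 (h i)) [set x | x = 1]) => //.
move=> z _; apply: (@continuous_big R _ +%R 0 predT) => [|i _]; [exact: add_continuous|exact: cont].
Qed.

Lemma incellE e z : incell e z <->
  in_face (fun i => z 0 (lshift N i)) e.1 /\ in_face (fun i => z 0 (rshift N i)) e.2.
Proof.
have -> : (fun i => z 0 (lshift N i)) = lft z by apply/funext => i; rewrite /lft mxE.
by have -> : (fun i => z 0 (rshift N i)) = rgt z by apply/funext => i; rewrite /rgt mxE.
Qed.

Lemma incell_01 e z i : incell e z -> 0 <= z 0 i <= 1.
Proof.
case=> l r; rewrite -(splitK i); case: (fintype.split i) => j /=.
  by have := in_face_le1 j l; rewrite /lft mxE.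
by have := in_face_le1 j r; rewrite /rgt mxE.
Qed.

Lemma incell_compact e : compact (incell e).
Proof.
have box := @rV_compact R (N + N) (fun=> `[0 : R, 1]%classic)
  (fun=> @segment_compact R 0 1).
apply: subclosed_compact box _ => [|z ez i]; last first.
  by rewrite /= in_itv; apply: incell_01 ez.
have -> : incell e = [set z | in_face (fun i => z 0 (lshift N i)) e.1] `&`
   [set z | in_face (fun i => z 0 (rshift N i)) e.2].
  by apply/funext => z; apply/propext; exact: incellE.
by apply: closedI; apply: in_face_closed.
Qed.

Lemma incell_spread e t : (forall z, z \in t -> incell e z) -> spread 1 t.
Proof.
move=> te z w /te zb /te wb i; rewrite ler_norml.
by have := incell_01 i zb; have := incell_01 i wb; lra.
Qed.

End Geometry.

(** * The pulled back Ky Fan cochain *)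

(** [(#|e.1| + #|e.2|).-1] is the number of vertices of a top simplex in a subdivided cell. It drops
    by one at each face, and truncation gives the augmentation the value 0. *)
Lemma mem_cell_faces (I : finType) (e e' : {set I} * {set I}) :
  e' \in cell_faces e -> (0 < #|e.1|)%N -> (0 < #|e.2|)%N ->
  [/\ e'.1 \subset e.1, e'.2 \subset e.2,
      (#|e'.1| + #|e'.2|).-1 = (#|e.1| + #|e.2|).-2
    & e' = (set0, set0) \/ ((0 < #|e'.1|)%N /\ (0 < #|e'.2|)%N)].
Proof.
case: e => s t /=; rewrite !mem_cat => /or3P[/mapP[i]|/mapP[i]|].
- rewrite mem_filter mem_enum => /andP[/= s1 is_] -> s0 t0 /=.
  have := cardsD1 i s; rewrite is_ add1n => cs.
  by split; [exact: subD1set|by []|lia|right; split=> //; lia].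
- rewrite mem_filter mem_enum => /andP[/= s1 is_] -> s0 t0 /=.
  have := cardsD1 i t; rewrite is_ add1n => cs.
  by split; [by []|exact: subD1set|lia|right; split=> //; lia].
case: andP => [[/eqP s1 /eqP t1]|_]; rewrite ?in_nil // mem_seq1 => /eqP -> _ _ /=.
by split; [exact: sub0set|exact: sub0set|rewrite cards0 s1 t1|left].
Qed.

Section Main.
Variables (R : realType) (d : nat).
Local Notation N := (2 * d + 3)%N.
Local Notation cell := ({set 'I_N} * {set 'I_N})%type.
Implicit Types (z : 'rV[R]_(N + N)) (e : cell).

Lemma flags_cell_local k (phi psi : seq 'rV[R]_(N + N) -> bool) e :
  e = (set0, set0) \/ ((0 < #|e.1|)%N /\ (0 < #|e.2|)%N) ->
  (forall s, size s = k -> (forall z, z \in s -> incell e z) -> phi s = psi s) ->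
  flags (@cell_faces _) (@cell_barycenter R d) k phi e =
  flags (@cell_faces _) (@cell_barycenter R d) k psi e.
Proof.
elim: k phi psi e => [|k IHk] phi psi e e0 eqs; first exact: eqs.
rewrite /= /cob big_seq [RHS]big_seq; apply: eq_bigr => e' e'e.
(* The augmentation has no faces, so no flag of positive length starts there. *)
have [e10 e20] : (0 < #|e.1|)%N /\ (0 < #|e.2|)%N.
  case: e0 => // E; move: e'e; rewrite E /cell_faces /= enum_set0 /=.
  by rewrite cards0.
have [s1 s2 _ v] := mem_cell_faces e'e e10 e20.
apply: IHk => // s sk se; apply: eqs => /=; first by rewrite sk.
move=> z; rewrite in_cons => /predU1P[->|/se[l r]].
  by apply: incell_barycenter; rewrite -card_gt0.
by split; [apply: in_face_sub l|apply: in_face_sub r].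
Qed.

Variable f : pt R d -> vec R d.
Hypothesis f_inj : almost_injective f.

Definition Pmap z : 'rV[R]_(2 * d) := \row_j Pf f (lft z) (rgt z) j.

Lemma dot_Pmap z1 z2 : dot (Pmap z1) (Pmap z2) =
  dotv (Pf f (lft z1) (rgt z1)) (Pf f (lft z2) (rgt z2)).
Proof. by apply: eq_bigr => j _; rewrite !mxE. Qed.

Lemma Pmap_swapz z : Pmap (swapz z) = - Pmap z.
Proof.
apply/rowP => j; rewrite !mxE lft_swapz rgt_swapz /Pf.
have -> : normv (fun k => f (rgt z) k - f (lft z) k) =
          normv (fun k => f (lft z) k - f (rgt z) k).
  by congr Num.sqrt; apply: eq_bigr => k _; rewrite -mulrNN !opprB.
by rewrite -mulNr opprB.
Qed.

Definition good_cell e : Prop :=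
  [/\ [disjoint e.1 & e.2], (0 < #|e.1| <= d.+1)%N & (0 < #|e.2| <= d.+1)%N].

Lemma good_cell_Conf2 e z : good_cell e -> incell e z -> Conf2 (lft z) (rgt z).
Proof.
case=> e12 /andP[e10 e1d] /andP[e20 e2d] [l r].
by exists e.1, e.2; split=> //; split=> //; rewrite -card_gt0.
Qed.

(** Almost injectivity enters here: it makes the denominator of [Pf] nonzero. *)
Lemma Pmap_unit e z : good_cell e -> incell e z -> dot (Pmap z) (Pmap z) = 1.
Proof.
case=> e12 /andP[e10 e1d] /andP[e20 e2d] [l r].
set v : vec R d := fun k => f (lft z) k - f (rgt z) k.
have nv : dotv v v != 0.
  have : f (lft z) <> f (rgt z).
    by apply: (f_inj _ _ e12) => //; split=> //; rewrite -card_gt0.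
  apply: contra_notN; rewrite psumr_eq0 => [/allP v0|i _]; last by rewrite -expr2 sqr_ge0.
  apply/funext => k; apply/eqP; rewrite -subr_eq0 -[_ == 0]orbb -mulf_eq0.
  by apply: v0; rewrite mem_index_enum.
have v0 : 0 <= dotv v v by apply: sumr_ge0 => i _; rewrite -expr2 sqr_ge0.
transitivity (\sum_j (v j * v j) / normv v ^+ 2).
  apply: eq_bigr => j _; by rewrite !mxE /Pf -/v mulf_div [normv v ^+ 2]expr2.
by rewrite -mulr_suml sqr_sqrtr // divff.
Qed.

Variable delta : R.
Hypothesis delta_adm : admissible f delta.
Hypothesis d0 : (0 < d)%N.
Hypothesis delta_small : delta < acos (- 1 / (2 * d)%:R).

Lemma inv2d_bound : -1 <= - 1 / (2 * d)%:R :> R /\ - 1 / (2 * d)%:R <= 1 :> R.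
Proof.
have n0 : 1 <= (2 * d)%:R :> R by rewrite ler1n; lia.
have n1 : 0 < (2 * d)%:R :> R by lra.
split; first by rewrite ler_pdivlMr //; lra.
by rewrite ler_pdivrMr //; lra.
Qed.

Lemma delta_pi : 0 <= delta <= pi.
Proof.
have [b1 b2] := inv2d_bound.
case: delta_adm => -> _ /=; apply: ltW (lt_le_trans delta_small _).
by apply: acos_lepi; rewrite b1 b2.
Qed.

Lemma cos_delta : 0 < 1 + (2 * d)%:R * cos delta.
Proof.
have [b1 b2] := inv2d_bound.
have n1 : 0 < (2 * d)%:R :> R by rewrite ltr0n; lia.
have : cos (acos (- 1 / (2 * d)%:R)) < cos delta.
  rewrite ltr_cos // in_itv /= ?delta_pi //.
  by rewrite acos_ge0 ?acos_lepi // b1 b2.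
rewrite acosK ?in_itv /= ?b1 ?b2 // ltr_pdivrMr //; lra.
Qed.

Lemma sdist_dot (u v : 'rV[R]_(2 * d)) : dot u u = 1 -> dot v v = 1 ->
  acos (dot u v) <= delta -> cos delta <= dot u v.
Proof.
move=> u1 v1 h; have uv := unit_dot_le1 u1 v1.
rewrite -[leRHS]acosK ?in_itv //= leNgt ltr_cos ?in_itv /= ?delta_pi //.
  by rewrite -leNgt.
by rewrite acos_ge0 ?acos_lepi.
Qed.

Lemma Pmap_lebesgue : exists2 eps : R, 0 < eps &
  forall e, good_cell e -> forall z1 z2, incell e z1 -> incell e z2 ->
  (forall i, `|z1 0 i - z2 0 i| < eps) -> cos delta <= dot (Pmap z1) (Pmap z2).
Proof.
have each e : exists2 eps : R, 0 < eps & good_cell e -> forall z1 z2,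
    incell e z1 -> incell e z2 ->
    (forall i, `|z1 0 i - z2 0 i| < eps) -> cos delta <= dot (Pmap z1) (Pmap z2).
  have [ge|nge] := pselect (good_cell e); last by exists 1.
  have [|eps eps0 H] := @lebesgue_number _ _ _
      (fun z1 z2 => cos delta <= dot (Pmap z1) (Pmap z2)) (incell_compact (e := e)).
    move=> z ez; case: delta_adm => _ /(_ _ _ (good_cell_Conf2 ge ez))[r r0 H].
    exists r => // z1 z2 ez1 ez2 zz1 zz2.
    apply: sdist_dot; rewrite ?(Pmap_unit ge) //.
    rewrite dot_Pmap; apply: H; first exact: good_cell_Conf2 ez1; first exact: good_cell_Conf2 ez2.
      by move=> i; rewrite /lft /rgt !mxE.
    by move=> i; rewrite /lft /rgt !mxE.
  by exists eps.
have [eps epsP] := choice (fun e => let: ex_intro2 x a b := each e in ex_intro _ x (conj a b)).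
(* There are finitely many cells, so the least of their Lebesgue numbers serves all. *)
exists (\big[Order.min/1]_e eps e).
  by elim/big_ind: _ => // [x y|e _]; [rewrite lt_min => -> ->|case: (epsP e)].
move=> e ge z1 z2 ez1 ez2 h; have [_ /(_ ge)] := epsP e; apply=> // i.
by apply: lt_le_trans (h i) _; apply: bigmin_le_cond.
Qed.

(* [m] subdivisions of the cells, then [m'] of the simplices spanned by the
   images of their vertices. *)
Definition pullback (m m' : nat) (phi : seq 'rV[R]_(2 * d) -> bool) k e : bool :=
  flags (@cell_faces _) (@cell_barycenter R d) k
    (iter m (@sd R _) (fun t => iter m' (@sd R _) phi (map Pmap t))) e.

(** Each layer is a cochain map. [map Pmap] acts on vertices only, so it commutes with taking faces
    whatever [Pmap] does inside a simplex. *)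
Lemma pullback_cob m m' phi k e :
  pullback m m' (cob (@faces _) phi) k.+1 e =
  cob (@cell_faces _) (pullback m m' phi k) e.
Proof.
rewrite /pullback -flags_cob; last exact: cob_cellK.
apply: eq_flags => t; rewrite -iter_sd_cob.
elim: m t => [|m IHm] t; last by rewrite !iterS; apply: eq_sd.
by rewrite /= iter_sd_cob cob_faces_map.
Qed.

Lemma pullback_add m m' phi psi k e :
  pullback m m' (fun t => phi t (+) psi t) k e =
  pullback m m' phi k e (+) pullback m m' psi k e.
Proof.
rewrite /pullback -flags_add; apply: eq_flags => t; rewrite -iter_sd_add.
elim: m t => [|m IHm] t; last by rewrite !iterS; apply: eq_sd.
by rewrite /= iter_sd_add.
Qed.

(** Swapping the factors is linear, so it passes through the first subdivisions; [Pmap] turns it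
    into negation, again linear, which passes through the others. *)
Lemma pullback_swap m m' phi k e :
  pullback m m' phi k (swap e) =
  pullback m m' (fun t => phi (map (fun u => - u) t)) k e.
Proof.
rewrite /pullback (flags_map (F := @cell_faces _) (b := @cell_barycenter R d) (g := @swapz R d)).
- apply: eq_flags => t.
  rewrite iter_sd_map => [|x y|a x]; last 2 first.
  + by rewrite /swapz !linearD add_row_mx.
  + by rewrite /swapz !linearZ scale_row_mx.
  elim: m t => [|m IHm] t; last by rewrite !iterS; apply: eq_sd.
  rewrite /= -iter_sd_map => [|x y|a x]; [|exact: opprD|by rewrite scalerN].
  by rewrite -!map_comp; congr (iter _ _ _ _); apply: eq_map => z /=; rewrite Pmap_swapz.
- by move=> psi x; rewrite cob_cell_swap.
- by move=> x; rewrite cell_barycenter_swap.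
Qed.

(** The empty sequence alternates vacuously. *)
Lemma pullback_nil m m' e : pullback m m' (@theta R _) 0 e = true.
Proof.
have sd_nil p n phi : iter n (@sd R p) phi [::] = phi [::].
  by elim: n => //= n; rewrite /sd /=.
by rewrite /pullback /= !sd_nil.
Qed.

(* [kappa] bounds the squared norm below on hulls of at most [2d+1] unit vectors
   with pairwise inner products at least [cos delta]; hence [r] bounds the sup
   norm below, as [2d * r^2 <= kappa]. *)
Let kappa : R := (1 + (2 * d)%:R * cos delta) / (2 * d).+1%:R.
Let r : R := kappa / (2 * d)%:R.

Lemma r_gt0 : 0 < r.
Proof.
by rewrite divr_gt0 ?divr_gt0 ?ltr0n ?cos_delta //; lia.
Qed.

Lemma hull_bounded_below e t u : good_cell e ->
  (size t <= (2 * d).+1)%N -> (forall z, z \in t -> incell e z) ->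
  (forall z1 z2, z1 \in t -> z2 \in t -> cos delta <= dot (Pmap z1) (Pmap z2)) ->
  hull (map Pmap t) u -> bounded_below r u.
Proof.
move=> ge tk te tc tu; have n0 : (0 < 2 * d)%N by lia.
have n1 : (1 : R) <= (2 * d)%:R by rewrite ler1n.
apply: dot_bounded_below => //; first exact: ltW r_gt0.
apply: (@le_trans _ _ kappa); last first.
  apply: hull_dot_ge tu; rewrite ?size_map ?cos_le1 //.
    by move=> _ /mapP[z /te ez ->]; apply: (Pmap_unit ge).
  by move=> _ _ /mapP[z1 z1t ->] /mapP[z2 z2t ->]; apply: tc.
have k1 : kappa <= 1.
  rewrite /kappa ler_pdivrMr ?ltr0n // mul1r -natr1 addrC lerD2r.
  by rewrite -[leRHS]mulr1 ler_wpM2l ?cos_le1 // ler0n.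
have k0 : 0 < kappa by rewrite divr_gt0 ?ltr0n ?cos_delta.
(* As [kappa <= 1 <= 2d], the factor [kappa / 2d] is at most 1; this choice of [r] avoids a square
   root. *)
have -> : (2 * d)%:R * r ^+ 2 = kappa * (kappa / (2 * d)%:R).
  by rewrite /r; field; rewrite pnatr_eq0; lia.
rewrite -[leRHS]mulr1 ler_wpM2l ?(ltW k0) // ler_pdivrMr ?mul1r; first exact: le_trans n1.
by rewrite ltr0n.
Qed.

Lemma unit_coord (n : nat) (u : 'rV[R]_n) i : dot u u = 1 -> `|u 0 i| <= 1.
Proof.
move=> u1; rewrite -(@expr_le1 _ 2) ?normr_ge0 // real_normK ?num_real // -u1 /dot (bigD1 i) //=.
by rewrite expr2 lerDl; apply: sumr_ge0 => j _; rewrite -expr2 sqr_ge0.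
Qed.

(** The first subdivisions make [Pmap] of the vertices nearly constant, so that their hull avoids 0;
    the second ones make the pieces of this hull smaller than [r]. *)
Lemma pullback_local : exists m m' D, D < r /\
  forall phi psi k e, good_cell e -> (k <= (2 * d).+1)%N ->
  (forall s, size s = k -> (forall u, u \in s -> bounded_below r u) ->
     spread D s -> phi s = psi s) ->
  pullback m m' phi k e = pullback m m' psi k e.
Proof.
have [eps eps0 lebesgue] := Pmap_lebesgue.
(* The initial spreads are 1 for a cell, with coordinates in [[0, 1]], and 2 for a set of unit
   vectors. *)
have [m mP] := exists_pow_lt (2 * d) (@ler01 R) eps0.
have [m' m'P] := exists_pow_lt (2 * d) (@ler0n R 2) r_gt0.
exists m, m', (((2 * d)%:R / (2 * d).+1%:R) ^+ m' * 2); split=> //.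
move=> phi psi k e ge kd eqs; apply: flags_cell_local.
  by right; case: ge => _ /andP[-> _] /andP[-> _].
move=> t tk te; rewrite -tk in kd eqs *.
apply: (iter_sd_local (@incell_bary_closed R d e) ler01 kd te (incell_spread te)).
move=> t' t't t'e t'D.
have close z1 z2 : z1 \in t' -> z2 \in t' -> cos delta <= dot (Pmap z1) (Pmap z2).
  move=> z1t z2t; apply: (lebesgue e) => // [||i]; [exact: t'e|exact: t'e|].
  exact: le_lt_trans (t'D _ _ z1t z2t i) mP.
apply: (@iter_sd_local _ _ (2 * d) m' 2 _ _ (hull (map Pmap t'))) => //.
- exact: hull_bary_closed.
- by rewrite size_map t't.
- by move=> u; apply: hull_mem.
- move=> _ _ /mapP[z1 /t'e e1 ->] /mapP[z2 /t'e e2 ->] i.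
  have := unit_coord i (Pmap_unit ge e1); have := unit_coord i (Pmap_unit ge e2).
  by move=> h1 h2; apply: le_trans (ler_normB _ _) _; lra.
move=> s; rewrite size_map t't => st sh sD; apply: eqs => // u /sh.
by apply: (hull_bounded_below ge _ t'e close); rewrite t't.
Qed.

Lemma admissible_contradiction : False.
Proof.
have [m [m' [D [Dr local]]]] := pullback_local.
have n0 : (0 < 2 * d)%N by lia.
pose X (e : cell) := pullback m m' (@theta R _) (#|e.1| + #|e.2|).-1 e.
have XD e : [disjoint e.1 & e.2] -> (0 < #|e.1| <= d.+1)%N ->
    (0 < #|e.2| <= d.+1)%N -> X e (+) X (swap e) = cob (@cell_faces _) X e.
  move=> e12 e1 e2; rewrite /X /= addnC.
  set k := (#|e.1| + #|e.2|).-2.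
  have ek : (#|e.2| + #|e.1|).-1 = k.+1 by rewrite /k; lia.
  rewrite ek pullback_swap -pullback_add.
  transitivity (pullback m m' (cob (@faces _) (@theta R _)) k.+1 e).
    apply: local => //; first by rewrite /k; lia.
    move=> s sk sr sD; rewrite (theta_cob n0 r_gt0 Dr) //.
    by rewrite -size_eq0 sk.
  rewrite pullback_cob /cob big_seq [RHS]big_seq; apply: eq_bigr => e' e'e.
  by have [_ _ -> _] := mem_cell_faces e'e (andP e1).1 (andP e2).1.
(* All [2d+3] vertices are used, with cells of type [(d+1, d+1)]. Their simplices have [2d+1]
   vertices, more than the [2d] coordinates, so [theta] vanishes on them. *)
have := @typed_sum _ d.+1 X XD d [set: 'I_N] (ltnSn d).
rewrite cardsT card_ord /X /= cards0 pullback_nil.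
rewrite big1 => [|e /and5P[_ _ e12 /eqP e1 /eqP e2]].
  by move=> H; have := H ltac:(lia).
transitivity (pullback m m' (fun=> false) (#|e.1| + #|e.2|).-1 e).
  apply: local; rewrite ?e1 ?e2 /=; [by split; rewrite ?e1 ?e2 /=|lia|].
  move=> s sk sr sD; apply: (theta_top n0 r_gt0 Dr) => //; rewrite sk; lia.
(* Additivity at [0 + 0 = 0] shows that the zero cochain pulls back to zero. *)
have := pullback_add m m' (fun=> false) (fun=> false) (#|e.1| + #|e.2|).-1 e.
by rewrite /=; case: (pullback _ _ _ _ _).
Qed.

End Main.

(** * The lower bound for [alpha2] *)

Theorem theorem3p11 (R : realType) (d : nat) (hd : (1 <= d)%N)
  (f : pt R d -> vec R d) :
  almost_injective f ->
  acos (- 1 / (2 * d)%:R) <= alpha2 f.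
Proof.
move=> f_inj; apply: lb_le_inf.
  (* A lower bound passes to [inf] only for a nonempty set; [pi] is admissible, being a bound for
     all distances on the sphere. *)
  exists pi; split; first exact: pi_ge0.
  move=> x y xy; exists 1 => // x1 y1 x2 y2 C1 C2 _ _; apply: acos_lepi.
  have unit x' y' : Conf2 x' y' -> exists z, [/\ x' = lft z, y' = rgt z
     & dot (Pmap f z) (Pmap f z) = 1].
    move=> [s [t [[s0 sd] [t0 td] st xs yt]]].
    have E : x' = lft (row_mx (\row_i x' i) (\row_i y' i)) /\
             y' = rgt (row_mx (\row_i x' i) (\row_i y' i)).
      by split; apply/funext => i; rewrite /lft /rgt ?row_mxKl ?row_mxKr mxE.
    exists (row_mx (\row_i x' i) (\row_i y' i)); case: E => E1 E2; split=> //.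
    apply: (@Pmap_unit _ _ _ f_inj (s, t)); last by rewrite /incell -E1 -E2.
    by split; rewrite ?card_gt0 ?s0 ?t0.
  have [z1 [-> -> u1]] := unit _ _ C1; have [z2 [-> -> u2]] := unit _ _ C2.
  by rewrite -dot_Pmap unit_dot_le1.
move=> delta adm; rewrite leNgt; apply/negP => small.
exact: (admissible_contradiction f_inj adm hd small).
Qed.
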